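(* Let $H$ be a Hopf algebra over a field $\mathbb{k}$, let $\Omega^\bullet(H)$ be a complete (bicovariant) differential calculus on $H$, let $B$ be a $\sigma$-twisted left $H$-module algebra with a $\sigma$-twisted $H$-module differential calculus $\Omega^\bullet(B)$, and let $\Omega^\bullet(B\sharp_\sigma H)$ be the corresponding (complete) crossed product calculus. Then the differential forms over the base space are $\Omega^\bullet(B)\otimes 1\cong\Omega^\bullet(B)$; that is, $\{\omega\in\Omega^\bullet(B\sharp_\sigma H):\Delta^\wedge_{B\sharp_\sigma H}(\omega)=\omega\otimes 1\}=\Omega^\bullet(B)\otimes 1$.
   Context: $H$ has coproduct $\Delta$, written $\Delta(h)=h_1\otimes h_2$ in Sweedler notation, and counit $\epsilon$. Left $H$-coactions are written $\eta\mapsto\eta_{-1}\otimes\eta_0$, and iterated ones $\eta\mapsto\eta_{-2}\otimes\eta_{-1}\otimes\eta_0$. A differential calculus on an algebra $A$ is a differential $\mathbb{N}_0$-graded algebra $(\Omega^\bullet,\wedge,\mathrm{d})$ with $\Omega^0=A$ and $\Omega^k=\mathrm{span}\{a^0\mathrm{d}a^1\wedge\cdots\wedge\mathrm{d}a^k : a^0,\dots,a^k\in A\}$. Tensor products of differential graded algebras carry the product $(\omega\otimes\eta)(\omega'\otimes\eta')=(-1)^{|\eta||\omega'|}(\omega\wedge\omega')\otimes(\eta\wedge\eta')$ and the differential $\omega\otimes\eta\mapsto\mathrm{d}\omega\otimes\eta+(-1)^{|\omega|}\omega\otimes\mathrm{d}\eta$. A calculus $\Omega^\bullet(H)$ is bicovariant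 if $\Delta$, viewed as left and right coaction of $H$ on itself, lifts to left and right $H$-coactions on $\Omega^\bullet(H)$ making it a graded comodule algebra with colinear differential. For a right $H$-comodule algebra $(A,\Delta_A)$, a calculus $\Omega^\bullet(A)$ is complete (with respect to $\Omega^\bullet(H)$) if $\Delta_A$ extends to a morphism of differential graded algebras $\Delta_A^\wedge:\Omega^\bullet(A)\to\Omega^\bullet(A)\otimes\Omega^\bullet(H)$; this extension is unique. In particular $\Omega^\bullet(H)$ is complete if $\Delta$ extends to a morphism of differential graded algebras $\Omega^\bullet(H)\to\Omega^\bullet(H)\otimes\Omega^\bullet(H)$. For a complete calculus $\Omega^\bullet(A)$, with base algebra the coinvariants $\{a\in A:\Delta_A(a)=a\otimes 1\}$, the differential forms over the base space are by definition the elements $\omega\in\Omega^\bullet(A)$ with $\Delta_A^\wedge(\omega)=\omega\otimes 1$. $H$ measures an algebra $B$ if there is a linear map $\cdot:H\otimes B\to B$ with $h\cdot 1_B=\epsilon(h)1_B$ and $h\cdot(bb')=(h_1\cdot b)(h_2\cdot b')$. A 2-cocycle with values in $B$ is a convolution invertible linear map $\sigma:H\otimes H\to B$ with $\sigma(h\otimes 1)=\epsilon(h)1_B=\sigma(1\otimes h)$ and $(h_1\cdot\sigma(h'_1\otimes h''_1))\sigma(h_2\otimes h'_2h''_2)=\sigma(h_1\otimes h'_1)\sigma(h_2h'_2\otimes h'')$; its convolution inverse is denoted $\sigma^{-1}$. $B$ is a $\sigma$-twisted left $H$-module (algebra) if moreover $1\cdot b=b$ and $h\cdot(h'\cdot b)=\sigma(h_1\otimes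 h'_1)((h_2h'_2)\cdot b)\sigma^{-1}(h_3\otimes h'_3)$. The crossed product algebra $B\sharp_\sigma H$ is $B\otimes H$ with product $(b\otimes h)(b'\otimes h')=b(h_1\cdot b')\sigma(h_2\otimes h'_1)\otimes h_3h'_2$; it is a right $H$-comodule algebra with coaction $\Delta_{B\sharp_\sigma H}=\mathrm{id}_B\otimes\Delta$ and coinvariants $B\otimes 1\cong B$. A calculus $(\Omega^\bullet(B),\mathrm{d}_B)$ is a $\sigma$-twisted $H$-module differential calculus if there are linear maps $\cdot:H\otimes\Omega^k(B)\to\Omega^k(B)$, $k\ge 1$, with $h\cdot(b^0\mathrm{d}_Bb^1\wedge\cdots\wedge\mathrm{d}_Bb^k)=(h_1\cdot b^0)(h_2\cdot\mathrm{d}_Bb^1)\wedge\cdots\wedge(h_{k+1}\cdot\mathrm{d}_Bb^k)$, $h\cdot\mathrm{d}_Bb=\mathrm{d}_B(h\cdot b)$, and $\mathrm{d}_B\circ\sigma=0$. Given such a calculus and a bicovariant calculus $(\Omega^\bullet(H),\mathrm{d}_H)$, the corresponding crossed product calculus is $\Omega^n(B\sharp_\sigma H)=\bigoplus_{i=0}^n\Omega^{n-i}(B)\otimes\Omega^i(H)$ with, for $\omega\in\Omega^i(B)$, $\eta\in\Omega^j(H)$, $\omega'\in\Omega^k(B)$, $\eta'\in\Omega^\ell(H)$, $(\omega\otimes\eta)\wedge(\omega'\otimes\eta')=(-1)^{jk}\big(\omega\wedge(\eta_{-2}\cdot\omega')\sigma(\eta_{-1}\otimes\eta'_{-1})\big)\otimes(\eta_0\wedge\eta'_0)$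 and $\mathrm{d}_{\sharp_\sigma}(\omega\otimes\eta)=\mathrm{d}_B\omega\otimes\eta+(-1)^i\omega\otimes\mathrm{d}_H\eta$; this is a right $H$-covariant differential calculus on $B\sharp_\sigma H$. *)

(* Defs.v *)
From HB Require Import structures.
From mathcomp Require Import all_boot all_algebra.
From mathcomp Require Import boolp classical_sets fsbigop.

Set Implicit Arguments.
Unset Strict Implicit.
Unset Printing Implicit Defensive.

Import GRing.Theory.
Local Open Scope ring_scope.

(* Tensor product over k of possibly infinite-dimensional spaces: formal sums
   of pairs, identified when no bilinear map separates them. The scalars of
   the free vector space are absorbed in the first component of the pairs. *)
Section TensorProduct.
Variables (k : fieldType) (U V : lmodType k).
Implicit Types (W : lmodType k) (s t : seq (U * V)).

Definition tsum_eq s t : bool :=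
  `[< forall W (f : {bilinear U -> V -> W}),
        \sum_(p <- s) f p.1 p.2 = \sum_(p <- t) f p.1 p.2 >].

Lemma tsum_eq_equiv : equiv_class_of tsum_eq.
Proof.
split=> [s|s t|t s u].
- exact/asboolP.
- by apply/asboolP/asboolP => H W f; rewrite H.
- by move=> /asboolP H /asboolP K; apply/asboolP => W f; rewrite H K.
Qed.

Canonical tsum_equiv := EquivRelPack tsum_eq_equiv.

Definition tensor : Type := {eq_quot tsum_equiv}%qT.

Definition tclass s : tensor := (\pi_({eq_quot tsum_equiv}) s)%qT.
Definition trepr (t : tensor) : seq (U * V) :=
  repr (t : {eq_quot tsum_equiv}%qT).

Lemma treprK : cancel trepr tclass.
Proof. exact: reprK. Qed.

Lemma tclassP s t :
  (forall W (f : {bilinear U -> V -> W}),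
     \sum_(p <- s) f p.1 p.2 = \sum_(p <- t) f p.1 p.2) <->
  tclass s = tclass t.
Proof.
split=> [H|/eqmodP/asboolP//].
by apply/eqmodP/asboolP.
Qed.

HB.instance Definition _ := Choice.copy tensor {eq_quot tsum_equiv}%qT.

Definition tfold (W : nmodType) (f : U -> V -> W) (t : tensor) : W :=
  \sum_(p <- trepr t) f p.1 p.2.

Lemma tfold_class W (f : {bilinear U -> V -> W}) s :
  tfold f (tclass s) = \sum_(p <- s) f p.1 p.2.
Proof. by move: W f; apply/tclassP; rewrite treprK. Qed.

Let tadd (x y : tensor) := tclass (trepr x ++ trepr y).
Let topp (x : tensor) := tclass [seq (- p.1, p.2) | p <- trepr x].
Let tscale (c : k) (x : tensor) := tclass [seq (c *: p.1, p.2) | p <- trepr x].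

Let tfold_inj (x y : tensor) :
  (forall W (f : {bilinear U -> V -> W}), tfold f x = tfold f y) -> x = y.
Proof. by move=> H; rewrite -[x]treprK -[y]treprK; apply/tclassP. Qed.

Let tfold_add W (f : {bilinear U -> V -> W}) x y :
  tfold f (tadd x y) = tfold f x + tfold f y.
Proof. by rewrite tfold_class big_cat. Qed.

Let tfold_scale W (f : {bilinear U -> V -> W}) c x :
  tfold f (tscale c x) = c *: tfold f x.
Proof.
rewrite tfold_class big_map scaler_sumr; apply: eq_bigr => p _ /=.
by rewrite linearZl_LR.
Qed.

Let tfold_opp W (f : {bilinear U -> V -> W}) x :
  tfold f (topp x) = - tfold f x.
Proof.
rewrite tfold_class big_map -sumrN; apply: eq_bigr => p _ /=.
by rewrite linearNl.
Qed.

Let tfold_zero W (f : {bilinear U -> V -> W}) : tfold f (tclass [::]) = 0.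
Proof. by rewrite tfold_class big_nil. Qed.

Let taddA : associative tadd.
Proof. by move=> x y z; apply: tfold_inj => W f; rewrite !tfold_add addrA. Qed.
Let taddC : commutative tadd.
Proof. by move=> x y; apply: tfold_inj => W f; rewrite !tfold_add addrC. Qed.
Let tadd0 : left_id (tclass [::]) tadd.
Proof.
by move=> x; apply: tfold_inj => W f; rewrite tfold_add tfold_zero add0r.
Qed.
Let taddN : left_inverse (tclass [::]) topp tadd.
Proof.
move=> x; apply: tfold_inj => W f.
by rewrite tfold_add tfold_opp tfold_zero addNr.
Qed.

HB.instance Definition _ := GRing.isZmodule.Build tensor taddA taddC tadd0 taddN.

Let tscaleA a b x : tscale a (tscale b x) = tscale (a * b) x.
Proof. by apply: tfold_inj => W f; rewrite !tfold_scale scalerA. Qed.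
Let tscale1 : left_id 1 tscale.
Proof. by move=> x; apply: tfold_inj => W f; rewrite tfold_scale scale1r. Qed.
Let tscaleDr : right_distributive tscale +%R.
Proof.
move=> c x y; apply: tfold_inj => W f.
by rewrite tfold_scale !tfold_add !tfold_scale scalerDr.
Qed.
Let tscaleDl x : {morph tscale^~ x : a b / a + b}.
Proof.
move=> a b; apply: tfold_inj => W f.
by rewrite tfold_add !tfold_scale scalerDl.
Qed.

HB.instance Definition _ :=
  GRing.Zmodule_isLmodule.Build k tensor tscaleA tscale1 tscaleDr tscaleDl.

Definition tpure (u : U) (v : V) : tensor := tclass [:: (u, v)].

Lemma tpure_bilinear : bilinear_for *:%R *:%R tpure.
Proof.
split=> z c x y; apply: tfold_inj => W f;
  rewrite tfold_add tfold_scale !tfold_class !big_seq1 /=.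
  by rewrite linearDl linearZl_LR.
by rewrite linearDr linearZr_LR.
Qed.

(* Universal property: a bilinear f factors through the linear map tfold f,
   and linear maps on the tensor product are determined on pure tensors. *)
Lemma tfold_linear W (f : U -> V -> W) :
  bilinear_for *:%R *:%R f -> linear (tfold f).
Proof.
move=> hf; pose m := bilinear_isBilinear.Build _ _ _ _ _ _ f hf.
pose F : {bilinear U -> V -> W} := HB.pack f m.
by move=> c x y; rewrite (tfold_add F) (tfold_scale F).
Qed.

Lemma tfold_pure W (f : U -> V -> W) u v :
  bilinear_for *:%R *:%R f -> tfold f (tpure u v) = f u v.
Proof.
move=> hf; pose m := bilinear_isBilinear.Build _ _ _ _ _ _ f hf.
pose F : {bilinear U -> V -> W} := HB.pack f m.
by rewrite (tfold_class F) big_seq1.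
Qed.

Lemma tensor_sum (x : tensor) : x = \sum_(p <- trepr x) tpure p.1 p.2.
Proof.
rewrite -[LHS]treprK; elim: (trepr x) => [|[u v] s IHs].
  by rewrite big_nil.
rewrite big_cons -IHs; apply: tfold_inj => W f.
by rewrite tfold_add !tfold_class big_cons big_seq1.
Qed.

Lemma tensor_ext W (F G : {linear tensor -> W}) :
  (forall u v, F (tpure u v) = G (tpure u v)) -> F =1 G.
Proof.
by move=> e x; rewrite (tensor_sum x) !linear_sum; apply: eq_bigr => p _; apply: e.
Qed.

End TensorProduct.

Notation "U ⨂ V" := (tensor U V) (at level 40, left associativity) : type_scope.
Notation "u ⊗ v" := (tpure u v) (at level 40, left associativity) : ring_scope.

(* Sweedler notation: for t = t_1 ⊗ t_2, the sum of E(t_1, t_2). It is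
   computed on a representative of t; wherever it is used E is bilinear in the
   bound variables, so that the result depends on t only. *)
Notation "\tsum_ ( a , b <- t ) E" := (tfold (fun a b => E) t)
  (at level 41, E at level 41, a name, b name,
   format "'[' \tsum_ ( a ,  b  <-  t ) '/  '  E ']'") : ring_scope.

Definition tmul (k : fieldType) (A B : algType k) (x y : A ⨂ B) : A ⨂ B :=
  \tsum_(a, b <- x) \tsum_(a', b' <- y) ((a * a') ⊗ (b * b')).

Record hopfAlg (k : fieldType) := HopfAlg {
  hopf_alg :> algType k;
  comul : {linear hopf_alg -> hopf_alg ⨂ hopf_alg};
  counit : {scalar hopf_alg};
  antipode : {linear hopf_alg -> hopf_alg};
  comulA : forall h,
    \tsum_(a, h3 <- comul h) \tsum_(h1, h2 <- comul a) (h1 ⊗ (h2 ⊗ h3)) =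
    \tsum_(h1, a <- comul h) (h1 ⊗ comul a);
  counitl : forall h, \tsum_(h1, h2 <- comul h) (counit h1 *: h2) = h;
  counitr : forall h, \tsum_(h1, h2 <- comul h) (counit h2 *: h1) = h;
  comul1 : comul 1 = 1 ⊗ 1;
  comulM : forall g h, comul (g * h) = tmul (comul g) (comul h);
  counit1 : counit 1 = 1;
  counitM : forall g h, counit (g * h) = counit g * counit h;
  antipodel : forall h,
    \tsum_(h1, h2 <- comul h) (antipode h1 * h2) = (counit h)%:A;
  antipoder : forall h,
    \tsum_(h1, h2 <- comul h) (h1 * antipode h2) = (counit h)%:A
}.

(* Differential calculus on A: [hcomp n] is the projection onto the degree n
   component, so that w has degree n iff [hcomp n w = w]. *)
Record calculus (k : fieldType) (A : algType k) := Calculus {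
  forms :> algType k;
  hcomp : nat -> {linear forms -> forms};
  dif : {linear forms -> forms};
  inj0 : {lrmorphism A -> forms};
  hcomp_hcomp : forall i j w,
    hcomp i (hcomp j w) = if i == j then hcomp j w else 0;
  hcomp_sum : forall w, exists N, w = \sum_(i < N) hcomp i w;
  hcompM : forall i j w w', hcomp i w = w -> hcomp j w' = w' ->
    hcomp (i + j) (w * w') = w * w';
  hcomp_dif : forall n w, hcomp n w = w -> hcomp n.+1 (dif w) = dif w;
  difM : forall n w w', hcomp n w = w ->
    dif (w * w') = dif w * w' + (-1) ^+ n *: (w * dif w');
  dif_dif : forall w, dif (dif w) = 0;
  inj0_inj : injective inj0;
  hcomp0 : forall w, hcomp 0 w = w <-> exists a, w = inj0 a;
  forms_span : forall n w, hcomp n w = w ->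
    exists s : seq (A * n.-tuple A),
      w = \sum_(p <- s) inj0 p.1 * \prod_(a <- p.2) dif (inj0 a)
}.

(* Bare data of a differential graded algebra, for the derived structures. *)
Record dgData (k : fieldType) := DGData {
  dg_car :> lmodType k;
  dg_one : dg_car;
  dg_mul : dg_car -> dg_car -> dg_car;
  dg_comp : nat -> dg_car -> dg_car;
  dg_dif : dg_car -> dg_car
}.

Definition dg_of (k : fieldType) (A : algType k) (O : calculus A) : dgData k :=
  DGData 1 (fun w w' : O => w * w') (fun n => hcomp O n) (dif O).

Record dg_morphism (k : fieldType) (X Y : dgData k) (f : {linear X -> Y}) :
    Prop := DGMorphism {
  dg_morph1 : f (dg_one X) = dg_one Y;
  dg_morphM : forall x y, f (dg_mul x y) = dg_mul (f x) (f y);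
  dg_morph_comp : forall n x, f (dg_comp n x) = dg_comp n (f x);
  dg_morph_dif : forall x, f (dg_dif x) = dg_dif (f x)
}.

(* In the formulas with signs, given in the literature on homogeneous elements,
   the arguments are expanded into their (finitely many nonzero) homogeneous
   components. *)
Section DGTensor.
Variables (k : fieldType) (X Y : dgData k).

Definition dgt_comp (n : nat) (x : X ⨂ Y) : X ⨂ Y :=
  \tsum_(w, e <- x) \sum_(i < n.+1) (dg_comp (n - i) w ⊗ dg_comp i e).

Definition dgt_dif (x : X ⨂ Y) : X ⨂ Y :=
  \tsum_(w, e <- x) (dg_dif w ⊗ e +
    \sum_(i \in [set: nat]) (-1) ^+ i *: (dg_comp i w ⊗ dg_dif e)).

Definition dgt_mul (x y : X ⨂ Y) : X ⨂ Y :=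
  \tsum_(w, e <- x) \tsum_(w', e' <- y)
    \sum_(j \in [set: nat]) \sum_(l \in [set: nat])
      (-1) ^+ (j * l) *:
        (dg_mul w (dg_comp l w') ⊗ dg_mul (dg_comp j e) e').

Definition dgTensor : dgData k :=
  DGData (dg_one X ⊗ dg_one Y) dgt_mul dgt_comp dgt_dif.

End DGTensor.

Record left_covariant (k : fieldType) (H : hopfAlg k) (O : calculus H)
    (lam : {linear O -> H ⨂ O}) : Prop := LeftCovariant {
  lcovA : forall w,
    \tsum_(a, w0 <- lam w) \tsum_(h1, h2 <- comul H a) (h1 ⊗ (h2 ⊗ w0)) =
    \tsum_(h, a <- lam w) (h ⊗ lam a);
  lcov_counit : forall w, \tsum_(h, w0 <- lam w) (counit H h *: w0) = w;
  lcov1 : lam 1 = 1 ⊗ 1;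
  lcovM : forall w w', lam (w * w') = tmul (lam w) (lam w');
  lcov_comp : forall n w,
    lam (hcomp O n w) = \tsum_(h, w0 <- lam w) (h ⊗ hcomp O n w0);
  lcov_inj0 : forall h,
    lam (inj0 O h) = \tsum_(h1, h2 <- comul H h) (h1 ⊗ inj0 O h2);
  lcov_dif : forall w, lam (dif O w) = \tsum_(h, w0 <- lam w) (h ⊗ dif O w0)
}.

Record right_covariant (k : fieldType) (H : hopfAlg k) (O : calculus H)
    (rho : {linear O -> O ⨂ H}) : Prop := RightCovariant {
  rcovA : forall w,
    \tsum_(a, h <- rho w) \tsum_(w0, g <- rho a) (w0 ⊗ (g ⊗ h)) =
    \tsum_(w0, a <- rho w) (w0 ⊗ comul H a);
  rcov_counit : forall w, \tsum_(w0, h <- rho w) (counit H h *: w0) = w;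
  rcov1 : rho 1 = 1 ⊗ 1;
  rcovM : forall w w', rho (w * w') = tmul (rho w) (rho w');
  rcov_comp : forall n w,
    rho (hcomp O n w) = \tsum_(w0, h <- rho w) (hcomp O n w0 ⊗ h);
  rcov_inj0 : forall h,
    rho (inj0 O h) = \tsum_(h1, h2 <- comul H h) (inj0 O h1 ⊗ h2);
  rcov_dif : forall w, rho (dif O w) = \tsum_(w0, h <- rho w) (dif O w0 ⊗ h)
}.

Record bicovCalculus (k : fieldType) (H : hopfAlg k) := BicovCalculus {
  bicov_cal :> calculus H;
  lcoact : {linear bicov_cal -> H ⨂ bicov_cal};
  rcoact : {linear bicov_cal -> bicov_cal ⨂ H};
  lcoactP : left_covariant lcoact;
  rcoactP : right_covariant rcoact
}.

Section Completeness.
Variables (k : fieldType) (H : hopfAlg k) (OH : calculus H).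
Variables (A : lmodType k) (coactA : A -> A ⨂ H).
Variables (OA : dgData k) (injA : A -> OA).

(* OA is a calculus on the comodule algebra A, embedded in degree 0 by injA. *)
Definition extends_coaction (D : {linear OA -> dgTensor OA (dg_of OH)}) : Prop :=
  dg_morphism D /\
  forall a, D (injA a) = \tsum_(a0, h <- coactA a) (injA a0 ⊗ inj0 OH h).

Definition complete : Prop := exists D, extends_coaction D.

Definition base_forms (D : {linear OA -> dgTensor OA (dg_of OH)}) : set OA :=
  [set w | D w = w ⊗ 1]%classic.

End Completeness.

Definition calculus_complete (k : fieldType) (H : hopfAlg k) (O : calculus H) :
    Prop :=
  complete O (comul H) (inj0 O : H -> dg_of O).

(* Measurings and cocycles are linear maps on tensor products; [cocV] is the
   convolution inverse of [coc]. *)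
Record twistedModule (k : fieldType) (H : hopfAlg k) (B : algType k) :=
    TwistedModule {
  act : {linear H ⨂ B -> B};
  coc : {linear H ⨂ H -> B};
  cocV : {linear H ⨂ H -> B};
  act_one : forall h, act (h ⊗ 1) = (counit H h)%:A;
  actM : forall h b b', act (h ⊗ (b * b')) =
    \tsum_(h1, h2 <- comul H h) (act (h1 ⊗ b) * act (h2 ⊗ b'));
  cocK : forall h g,
    \tsum_(h1, h2 <- comul H h) \tsum_(g1, g2 <- comul H g)
      (coc (h1 ⊗ g1) * cocV (h2 ⊗ g2)) = (counit H h * counit H g)%:A;
  cocVK : forall h g,
    \tsum_(h1, h2 <- comul H h) \tsum_(g1, g2 <- comul H g)
      (cocV (h1 ⊗ g1) * coc (h2 ⊗ g2)) = (counit H h * counit H g)%:A;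
  coc1r : forall h, coc (h ⊗ 1) = (counit H h)%:A;
  coc1l : forall h, coc (1 ⊗ h) = (counit H h)%:A;
  cocycle : forall f g h,
    \tsum_(f1, f2 <- comul H f) \tsum_(g1, g2 <- comul H g)
      \tsum_(h1, h2 <- comul H h)
        (act (f1 ⊗ coc (g1 ⊗ h1)) * coc (f2 ⊗ (g2 * h2))) =
    \tsum_(f1, f2 <- comul H f) \tsum_(g1, g2 <- comul H g)
      (coc (f1 ⊗ g1) * coc ((f2 * g2) ⊗ h));
  act1 : forall b, act (1 ⊗ b) = b;
  act_act : forall h g b, act (h ⊗ act (g ⊗ b)) =
    \tsum_(a, h3 <- comul H h) \tsum_(h1, h2 <- comul H a)
    \tsum_(c, g3 <- comul H g) \tsum_(g1, g2 <- comul H c)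
      (coc (h1 ⊗ g1) * act ((h2 * g2) ⊗ b) * cocV (h3 ⊗ g3))
}.

(* [diag_act a h x0 [:: x1; ...; xk]] is
   (h_1 . x0) (h_2 . x1) ... (h_{k+1} . xk). *)
Fixpoint diag_act (k : fieldType) (H : hopfAlg k) (W : algType k)
    (a : H ⨂ W -> W) (h : H) (x : W) (s : seq W) : W :=
  if s is y :: s' then
    \tsum_(h1, h2 <- comul H h) (a (h1 ⊗ x) * diag_act a h2 y s')
  else a (h ⊗ x).

Record twistedCalculus (k : fieldType) (H : hopfAlg k) (B : algType k)
    (T : twistedModule H B) := TwistedCalculus {
  tw_cal :> calculus B;
  form_act : {linear H ⨂ tw_cal -> tw_cal};
  form_act_hcomp : forall n h w, hcomp tw_cal n w = w ->
    hcomp tw_cal n (form_act (h ⊗ w)) = form_act (h ⊗ w);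
  form_act_inj0 : forall h b,
    form_act (h ⊗ inj0 tw_cal b) = inj0 tw_cal (act T (h ⊗ b));
  form_act_prod : forall h b (s : seq B),
    form_act (h ⊗ (inj0 tw_cal b * \prod_(c <- s) dif tw_cal (inj0 tw_cal c))) =
    diag_act form_act h (inj0 tw_cal b)
      [seq dif tw_cal (inj0 tw_cal c) | c <- s];
  form_act_dif : forall h b, form_act (h ⊗ dif tw_cal (inj0 tw_cal b)) =
    dif tw_cal (inj0 tw_cal (act T (h ⊗ b)));
  dif_coc : forall x, dif tw_cal (inj0 tw_cal (coc T x)) = 0
}.

Section CrossedProduct.
Variables (k : fieldType) (H : hopfAlg k) (OH : bicovCalculus H).
Variables (B : algType k) (T : twistedModule H B) (OB : twistedCalculus T).

Definition crossed_coact (x : B ⨂ H) : (B ⨂ H) ⨂ H :=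
  \tsum_(b, h <- x) \tsum_(h1, h2 <- comul H h) ((b ⊗ h1) ⊗ h2).

(* For homogeneous arguments, the product
     (w ⊗ e) (w' ⊗ e') = (-1)^(|e||w'|)
       (w (e_{-2} . w') σ(e_{-1} ⊗ e'_{-1})) ⊗ (e_0 e'_0)
   without its sign. In degree 0 it is the product of the crossed product
   algebra B ♯_σ H, embedded by [crossed_inj]. *)
Definition crossed_term (w : OB) (e : OH) (w' : OB) (e' : OH) : OB ⨂ OH :=
  \tsum_(a, e0 <- lcoact OH e) \tsum_(h1, h2 <- comul H a)
  \tsum_(g, e0' <- lcoact OH e')
    ((w * form_act OB (h1 ⊗ w') * inj0 OB (coc T (h2 ⊗ g))) ⊗ (e0 * e0')).

Definition crossed_fmul (x y : OB ⨂ OH) : OB ⨂ OH :=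
  \tsum_(w, e <- x) \tsum_(w', e' <- y)
    \sum_(j \in [set: nat]) \sum_(l \in [set: nat])
      (-1) ^+ (j * l) *: crossed_term w (hcomp OH j e) (hcomp OB l w') e'.

Definition crossed_dg : dgData k :=
  DGData (1 ⊗ 1) crossed_fmul
    (@dgt_comp k (dg_of OB) (dg_of OH)) (@dgt_dif k (dg_of OB) (dg_of OH)).

Definition crossed_inj (x : B ⨂ H) : crossed_dg :=
  \tsum_(b, h <- x) (inj0 OB b ⊗ inj0 OH h).

Definition crossed_extension
    (D : {linear crossed_dg -> dgTensor crossed_dg (dg_of OH)}) : Prop :=
  extends_coaction crossed_coact crossed_inj D.

Definition crossed_complete : Prop := complete OH crossed_coact crossed_inj.

End CrossedProduct.

(* Main.v *)
Require Import Defs.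
From HB Require Import structures.
From mathcomp Require Import all_boot all_algebra.
From mathcomp Require Import boolp classical_sets fsbigop.

Set Implicit Arguments.
Unset Strict Implicit.
Unset Printing Implicit Defensive.

Import GRing.Theory.
Local Open Scope ring_scope.
Local Open Scope classical_set_scope.

(** Let Δ^ be the extension of the coproduct to forms on H, with
    Δ^(η) = η_(1) ⊗ η_(2), and λ the left coaction. The extension of the coaction
    of the crossed product is D = id ⊗ Δ^, that is
      D (ω ⊗ η) = (ω ⊗ η_(1)) ⊗ η_(2),
    and its coinvariants are computed with the counit. There are three points.

    Existence. Compatibility of D = id ⊗ Δ^ with degrees and differentials is
    that of Δ^, up to counting signs. For the product, both D ((ω ⊗ η)(ω' ⊗ η'))
    and the product of D (ω ⊗ η) and D (ω' ⊗ η') expand into terms of the form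
      ω (h · ω') σ(h' ⊗ g) ⊗ .. ⊗ ..,
    where in the first one coacts on η and η' and then applies Δ^, and in the
    second one applies Δ^ and then coacts on η_(1) and η'_(1). The two agree by
    the identity (id ⊗ Δ^) λ = (λ ⊗ id) Δ^ ([Delta_lcoact]), which holds on
    generators of the calculus on H and hence everywhere. The Koszul signs match
    because the degree of η is that of η_(1) plus that of η_(2) ([Delta_par]).
    The conclusion is [crossed_Delta_mul].

    Uniqueness. The crossed product calculus is generated by degree 0. Indeed
    ω ⊗ η = (ω ⊗ 1)(1 ⊗ η) and ω |-> ω ⊗ 1 is multiplicative, while 1 ⊗ η η' is
    recovered from products by inverting the cocycle ([crossed_one_tensor_mul]):
      1 ⊗ η η' = (σ^-1(η_{-1} ⊗ η'_{-1}) ⊗ 1) ((1 ⊗ η_0) (1 ⊗ η'_0)).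
    So an extension of the coaction is determined by induction on the degree
    ([crossed_extension_unique]).

    Base forms. The counit of H, extended by 0 to positive degrees, is a left
    counit for Δ^ ([Delta_counit]). Applying it to the middle factor of
    D x = x ⊗ 1 yields x = (id ⊗ ε)(x) ⊗ 1 ([crossed_Delta_coinvariant]).

    Identities between tensors are checked on pure tensors of homogeneous
    elements, once both sides are known to be linear ([tensor_ind], [gr_ind],
    [tensor_homog_ind]); the tactic [lin] discharges the linearity conditions. *)

(** * Linear expressions in tensors *)

Section Linearity.
Variable k : fieldType.
Implicit Types U V W X : lmodType k.

Lemma linear_idfun U : linear (fun x : U => x).
Proof. by []. Qed.

Lemma linear_compose U V W (f : V -> W) (g : U -> V) :
  linear f -> linear g -> linear (fun x => f (g x)).
Proof. by move=> hf hg c x y; rewrite hg hf. Qed.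

Lemma linear_add U V (f g : U -> V) :
  linear f -> linear g -> linear (fun x => f x + g x).
Proof. by move=> hf hg c x y; rewrite hf hg scalerDr addrACA. Qed.

Lemma linear_scale U V (f : U -> V) (c : k) :
  linear f -> linear (fun x => c *: f x).
Proof. by move=> hf d x y; rewrite hf scalerDr !scalerA mulrC. Qed.

Lemma linear_coef U V (f : {scalar V}) (g : U -> V) W (w : W) :
  linear g -> linear (fun x => f (g x) *: w).
Proof. by move=> hg c x y; rewrite hg linearP scalerDl scalerA. Qed.

Lemma linear_mull U (A : algType k) (f : U -> A) (a : A) :
  linear f -> linear (fun x => f x * a).
Proof. by move=> hf c x y; rewrite hf mulrDl scalerAl. Qed.

Lemma linear_mulr U (A : algType k) (f : U -> A) (a : A) :
  linear f -> linear (fun x => a * f x).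
Proof. by move=> hf c x y; rewrite hf mulrDr scalerAr. Qed.

Lemma linear_bigsum U V (I : Type) (r : seq I) (P : pred I) (f : I -> U -> V) :
  (forall i, linear (f i)) -> linear (fun x => \sum_(i <- r | P i) f i x).
Proof.
move=> hf c x y; rewrite scaler_sumr -big_split /=.
by apply: eq_bigr => i _; rewrite hf.
Qed.

Lemma linear_tpurel U V W (f : U -> V) (w : W) :
  linear f -> linear (fun x => f x ⊗ w).
Proof. by move=> hf c x y; rewrite hf (tpure_bilinear V W).1. Qed.

Lemma linear_tpurer U V W (f : U -> V) (w : W) :
  linear f -> linear (fun x => w ⊗ f x).
Proof. by move=> hf c x y; rewrite hf (tpure_bilinear W V).2. Qed.

(** As tfold is a finite sum over a fixed representative of t, linearity of each
    term suffices. *)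
Lemma linear_tfoldf U V W X (t : V ⨂ W) (g : U -> V -> W -> X) :
  (forall v w, linear (fun x => g x v w)) -> linear (fun x => tfold (g x) t).
Proof. by move=> hg; apply: linear_bigsum. Qed.

Lemma linear_tfoldt U V W X (t : U -> V ⨂ W) (g : V -> W -> X) :
  bilinear_for *:%R *:%R g -> linear t -> linear (fun x => tfold g (t x)).
Proof. by move=> hg ht; apply: linear_compose ht; apply: tfold_linear. Qed.

Lemma linear_fun0 U V (f : U -> V) : linear f -> f 0 = 0.
Proof.
move=> hf; have := hf 1 0 0; rewrite !scale1r addr0.
by move/(congr1 (fun x => x - f 0)); rewrite subrr addrK.
Qed.

Lemma linear_fun_sum U V (f : U -> V) I (r : seq I) (P : pred I) (g : I -> U) :
  linear f -> f (\sum_(i <- r | P i) g i) = \sum_(i <- r | P i) f (g i).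
Proof.
move=> hf; apply: (big_morph f) => [x y|]; last exact: linear_fun0.
by rewrite -[x]scale1r hf !scale1r.
Qed.

Lemma linear_funZ U V (f : U -> V) c x : linear f -> f (c *: x) = c *: f x.
Proof. by move=> hf; rewrite -[c *: x]addr0 hf linear_fun0 // addr0. Qed.

Lemma linear_funD U V (f : U -> V) x y : linear f -> f (x + y) = f x + f y.
Proof. by move=> hf; have := hf 1 x y; rewrite !scale1r. Qed.

Lemma linear_fun_tfold U V W X (f : W -> X) (g : U -> V -> W) t :
  linear f -> f (tfold g t) = tfold (fun u v => f (g u v)) t.
Proof. by move=> hf; rewrite /tfold linear_fun_sum. Qed.

Lemma tensor_ind U V W (f g : U ⨂ V -> W) : linear f -> linear g ->
  (forall u v, f (u ⊗ v) = g (u ⊗ v)) -> f =1 g.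
Proof.
move=> hf hg e x; rewrite (tensor_sum x) !linear_fun_sum //.
by apply: eq_bigr => p _.
Qed.

Lemma eq_tfold U V (W : nmodType) (f g : U -> V -> W) t :
  (forall u v, f u v = g u v) -> tfold f t = tfold g t.
Proof. by move=> e; apply: eq_bigr => p _. Qed.

Lemma exchange_tfold U V U' V' (W : nmodType) (f : U -> V -> U' -> V' -> W) t s :
  \tsum_(a, b <- t) \tsum_(a', b' <- s) f a b a' b' =
  \tsum_(a', b' <- s) \tsum_(a, b <- t) f a b a' b'.
Proof. exact: exchange_big. Qed.

Lemma bilinear_l U V W (f : U -> V -> W) :
  bilinear_for *:%R *:%R f -> forall v, linear (fun u => f u v).
Proof. by case. Qed.

Lemma bilinear_r U V W (f : U -> V -> W) :
  bilinear_for *:%R *:%R f -> forall u, linear (f u).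
Proof. by case. Qed.

End Linearity.

Create HintDb lin discriminated.
#[global] Hint Opaque tfold tpure dgt_mul dgt_dif dgt_comp crossed_fmul tmul : lin.
#[global] Hint Resolve linear_idfun : lin.

(* Splits fun x => h x (f x) into h and f. The bound variable has an unusual
   name so as not to capture a variable of the context occurring in F. *)
Ltac fun_head F :=
  lazymatch type of F with ?T -> _ =>
    constr:(fun lin_var : T => ltac:(let b := eval cbv beta in (F lin_var) in
      lazymatch b with ?h _ => exact h end)) end.
Ltac fun_arg F :=
  lazymatch type of F with ?T -> _ =>
    constr:(fun lin_var : T => ltac:(let b := eval cbv beta in (F lin_var) in
      lazymatch b with _ ?f => exact f end)) end.

(* Reduces linearity of x |-> h (f x) or x |-> h (f x) c to that of h and f. *)
Ltac lin_app F :=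
  let h := fun_head F in let f := fun_arg F in
  lazymatch h with
  | (fun _ => ?h0) => apply: (@linear_compose _ _ _ _ h0 f); cbv beta
  | _ =>
    lazymatch f with (fun _ => ?c) =>
    let f1 := fun_arg h in let h1 := fun_head h in
    lazymatch h1 with
    | (fun _ => ?h0) =>
        apply: (@linear_compose _ _ _ _ (fun y => h0 y c) f1); cbv beta
    end end
  end.

(* Proves linearity or bilinearity by recursion on the expression. The bilinear
   constructors are treated before the hints, since trying to unify these with
   large sums is slow. Matching an argument against (fun _ => ?c) tests that it
   does not depend on the variable. *)
Ltac lin_step :=
  lazymatch goal with
  | |- bilinear_for _ _ _ => split => ?; cbv beta
  | |- forall _, _ => intro; cbv beta
  | |- GRing.linear_for _ (fun x => x) => exact: linear_idfun
  | |- GRing.linear_for _ (fun x => @?f x + @?g x) =>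
      apply: linear_add; cbv beta
  | |- GRing.linear_for _ (fun x => @?f x *: @?g x) =>
      lazymatch f with
      | (fun _ => ?c) => apply: linear_scale; cbv beta
      | _ => apply: linear_coef; cbv beta
      end
  | |- GRing.linear_for _ (fun x => @?f x * @?g x) =>
      lazymatch f with
      | (fun _ => ?c) => apply: linear_mulr; cbv beta
      | _ => apply: linear_mull; cbv beta
      end
  | |- GRing.linear_for _ (fun x => @?f x ⊗ @?g x) =>
      lazymatch f with
      | (fun _ => ?c) => apply: linear_tpurer; cbv beta
      | _ => apply: linear_tpurel; cbv beta
      end
  | |- GRing.linear_for _ (fun x => tfold (@?g x) (@?t x)) =>
      lazymatch g with
      | (fun _ => ?c) => apply: linear_tfoldt; cbv beta
      | _ => apply: linear_tfoldf; cbv beta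
      end
  | |- GRing.linear_for _ (fun x => bigop _ _ _) =>
      apply: linear_bigsum; cbv beta
  | |- GRing.linear_for _ (GRing.mul _) =>
      apply: linear_mulr; exact: linear_idfun
  | |- GRing.linear_for _ (tpure _) =>
      apply: linear_tpurer; exact: linear_idfun
  | |- GRing.linear_for _ (tfold _) => apply: tfold_linear
  | |- GRing.linear_for _ ?b =>
      first [ solve [by auto with lin nocore] | exact: linearP |
        lazymatch goal with
        | |- GRing.linear_for _ (fun x => @?b x) => lin_app b
        end ]
  end.
Ltac lin := cbv beta; repeat lin_step.

(** * Graded spaces and Koszul signs *)

Lemma fsum_bounded (V : zmodType) (f : nat -> V) N :
  (forall i, (N <= i)%N -> f i = 0) -> \sum_(i \in [set: nat]) f i = \sum_(i < N) f i.
Proof.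
move=> f0; rewrite fsbig_ord; apply/esym/fsbig_widen => // i [_ /= /negP].
by rewrite -leqNgt => /f0.
Qed.

Section Grading.
Variables (k : fieldType) (X : lmodType k) (c : nat -> X -> X).

Record grading : Prop := Grading {
  gr_lin : forall n, linear (c n);
  gr_idem : forall i j x, c i (c j x) = if i == j then c j x else 0;
  gr_sum : forall x, exists N, x = \sum_(i < N) c i x
}.

Hypothesis hc : grading.
Local Hint Resolve gr_lin : lin.

Lemma gr_at n x i : c n x = x -> c i x = if i == n then x else 0.
Proof. by move=> <-; rewrite gr_idem. Qed.

Lemma gr_homog n x : c n (c n x) = c n x.
Proof. by rewrite gr_idem // eqxx. Qed.

Lemma gr_ind (V : lmodType k) (f g : X -> V) : linear f -> linear g ->
  (forall n x, c n x = x -> f x = g x) -> f =1 g.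
Proof.
move=> hf hg e x; have [N ->] := gr_sum hc x; rewrite !linear_fun_sum //.
by apply: eq_bigr => i _; rewrite (e i) // gr_homog.
Qed.

Lemma gr_vanish x : exists N, forall i, (N <= i)%N -> c i x = 0.
Proof.
have [N ->] := gr_sum hc x; exists N => i hi.
rewrite (linear_fun_sum _ _ _ (gr_lin hc i)) big1 // => j _.
by rewrite gr_idem // gtn_eqF // (leq_trans (ltn_ord j)).
Qed.

(** The bound N depends on x only, so that sums built from several F or several
    x can be truncated at a common place. *)
Lemma gsum_fin x : exists N, forall M, (N <= M)%N -> forall (V : lmodType k)
    (F : nat -> X -> V), (forall i, linear (F i)) ->
  \sum_(i \in [set: nat]) F i (c i x) = \sum_(i < M) F i (c i x).
Proof.
have [N hN] := gr_vanish x; exists N => M hM V F hF.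
by apply: fsum_bounded => i hi; rewrite hN ?linear_fun0 // (leq_trans hM).
Qed.

Lemma linear_gsum (V : lmodType k) (F : nat -> X -> V) :
  (forall i, linear (F i)) ->
  linear (fun x => \sum_(i \in [set: nat]) F i (c i x)).
Proof.
move=> hF a x y.
have [N1 h1] := gsum_fin x; have [N2 h2] := gsum_fin y.
have [N3 h3] := gsum_fin (a *: x + y).
pose M := maxn N1 (maxn N2 N3).
rewrite (h1 M) ?leq_maxl // (h2 M) // ?(h3 M) // /M ?leq_max ?leqnn ?orbT //.
suff L : linear (fun x => \sum_(i < M) F i (c i x)) by exact: L.
by apply: linear_bigsum => i; have ci := gr_lin hc i; lin.
Qed.

Lemma gsum_at (V : lmodType k) (F : nat -> X -> V) n x :
  (forall i, linear (F i)) -> c n x = x ->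
  \sum_(i \in [set: nat]) F i (c i x) = F n x.
Proof.
move=> hF hx; have [N h] := gsum_fin x.
rewrite (h (maxn N n.+1)) ?leq_maxl //.
have hn : (n < maxn N n.+1)%N by rewrite leq_maxr.
rewrite (bigD1 (Ordinal hn)) //= hx big1 ?addr0 // => i hi.
rewrite (gr_at _ hx) ifN ?linear_fun0 //.
Qed.

(** Moving a form of degree l past x produces the sign (-1)^(i l) on the degree i
    component of x. Recording it as an operator avoids splitting x itself. *)
Definition par l x := \sum_(i \in [set: nat]) (-1) ^+ (i * l) *: c i x.

Lemma par_lin l : linear (par l).
Proof. by apply: (@linear_gsum _ (fun i x => (-1) ^+ (i * l) *: x)) => i; lin. Qed.

Lemma par_at l n x : c n x = x -> par l x = (-1) ^+ (n * l) *: x.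
Proof. by move=> hx; rewrite /par (@gsum_at _ (fun i x =>
  (-1) ^+ (i * l) *: x) n) // => i; lin. Qed.

Lemma par0 x : par 0 x = x.
Proof.
move: x; apply: (gr_ind (g := fun x => x)) => [||n x hx]; [exact: par_lin | by [] |].
by rewrite (par_at 0 hx) muln0 scale1r.
Qed.

Lemma par_par l m x : par m (par l x) = par (l + m) x.
Proof.
move: x; apply: gr_ind => [||n x hx]; try exact: par_lin.
  by have h := par_lin; lin.
rewrite (par_at l hx) (linear_funZ _ _ (par_lin m)) !(par_at _ hx).
by rewrite scalerA mulnDr exprD.
Qed.

End Grading.

Section Koszul.
Variables (k : fieldType) (X Y V : lmodType k).
Variables (c : nat -> X -> X) (d : nat -> Y -> Y).
Hypotheses (hc : grading c) (hd : grading d).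

(** The value f y x with the Koszul sign (-1)^(|y| |x|), which is the common shape
    of the products on tensor products of calculi and on the crossed product. *)
Definition koszul (f : Y -> X -> V) y x :=
  \sum_(j \in [set: nat]) \sum_(l \in [set: nat]) (-1) ^+ (j * l) *: f (d j y) (c l x).

Lemma koszul_fin y x : exists N, forall M, (N <= M)%N -> forall f,
    bilinear_for *:%R *:%R f ->
  koszul f y x = \sum_(j < M) \sum_(l < M) (-1) ^+ (j * l) *: f (d j y) (c l x).
Proof.
have [N1 h1] := gsum_fin hd y; have [N2 h2] := gsum_fin hc x.
exists (maxn N1 N2) => M; rewrite geq_max => /andP[/h1 {}h1 /h2 {}h2] f hf.
have f1 := bilinear_l hf; have f2 := bilinear_r hf.
have e j : \sum_(l \in [set: nat]) (-1) ^+ (j * l) *: f (d j y) (c l x) =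
    \sum_(l < M) (-1) ^+ (j * l) *: f (d j y) (c l x).
  by apply: (h2 _ (fun l x => (-1) ^+ (j * l) *: f (d j y) x)) => l; lin.
rewrite /koszul; under eq_fsbigr do rewrite e.
apply: (h1 _ (fun j y => \sum_(l < M) (-1) ^+ (j * l) *: f y (c l x))) => j.
by apply: linear_bigsum => l; apply: linear_scale; apply: f1.
Qed.

Lemma koszul_bilinear f : bilinear_for *:%R *:%R f ->
  bilinear_for *:%R *:%R (koszul f).
Proof.
move=> hf; have f1 := bilinear_l hf; have f2 := bilinear_r hf;
  split=> [x a y1 y2|y a x1 x2].
  have [N1 h1] := koszul_fin y1 x; have [N2 h2] := koszul_fin y2 x.
  have [N3 h3] := koszul_fin (a *: y1 + y2) x.
  pose M := maxn N1 (maxn N2 N3).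
  rewrite /= (h1 M) ?leq_maxl // (h2 M) // ?(h3 M) // /M ?leq_max ?leqnn ?orbT //.
  suff L : linear (fun y => \sum_(j < M) \sum_(l < M) (-1) ^+ (j * l) *: f (d j y) (c l x)).
    exact: L.
  by have dl := gr_lin hd; lin.
have [N1 h1] := koszul_fin y x1; have [N2 h2] := koszul_fin y x2.
have [N3 h3] := koszul_fin y (a *: x1 + x2).
pose M := maxn N1 (maxn N2 N3).
rewrite (h1 M) ?leq_maxl // (h2 M) // ?(h3 M) // /M ?leq_max ?leqnn ?orbT //.
suff L : linear (fun x => \sum_(j < M) \sum_(l < M) (-1) ^+ (j * l) *: f (d j y) (c l x)).
  exact: L.
by have cl := gr_lin hc; lin.
Qed.

Lemma linear_koszul (U : lmodType k) (f : U -> Y -> X -> V) y x :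
  (forall u, bilinear_for *:%R *:%R (f u)) ->
  (forall y x, linear (fun u => f u y x)) ->
  linear (fun u => koszul (f u) y x).
Proof.
move=> hf hl a u v; have [N h] := koszul_fin y x.
rewrite !(h N) //.
suff L : linear (fun u => \sum_(j < N) \sum_(l < N) (-1) ^+ (j * l) *: f u (d j y) (c l x)).
  exact: L.
by lin.
Qed.

(** For homogeneous x the double sum over degrees collapses to one sign
    operator on y. *)
Lemma koszul_at f y l x : bilinear_for *:%R *:%R f -> c l x = x ->
  koszul f y x = f (par d l y) x.
Proof.
move=> hf hx; have f1 := bilinear_l hf; have f2 := bilinear_r hf.
move: y; apply: (gr_ind hd (f := fun y => koszul f y x) (g :=
  fun y => f (par d l y) x)) => [||n y hy]; first exact: (koszul_bilinear hf).1.
  by apply: (@linear_compose _ _ _ _ (f^~ _)) => //; apply: par_lin.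
have e j : \sum_(l \in [set: nat]) (-1) ^+ (j * l) *: f (d j y) (c l x) =
    (-1) ^+ (j * l) *: f (d j y) x.
  by apply: (gsum_at hc (F := fun l x => (-1) ^+ (j * l) *: f (d j y) x)) => // i; lin.
rewrite /koszul; under eq_fsbigr do rewrite e.
rewrite (gsum_at hd (F := fun j y => (-1) ^+ (j * l) *: f y x) (n := n)) //.
  by rewrite (par_at hd l hy) (linear_funZ _ _ (f1 x)).
by move=> j; apply: linear_scale; apply: f1.
Qed.

End Koszul.

(** * Tensor products of differential graded data *)

Section Regular.
Variable k : fieldType.

(** Data whose operations are linear, which is what allows one to compute in their
    tensor products on pure tensors of homogeneous elements. *)
Record dg_regular (X : dgData k) : Prop := DGRegular {
  reg_grading : grading (@dg_comp k X);
  reg_dif : linear (@dg_dif k X);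
  reg_mull : forall y, linear (fun x => @dg_mul k X x y);
  reg_mulr : forall x, linear (@dg_mul k X x)
}.

Variables X Y : dgData k.
Hypotheses (hX : dg_regular X) (hY : dg_regular Y).

Let cX := reg_grading hX.
Let cY := reg_grading hY.
Let cXl := gr_lin cX.
Let cYl := gr_lin cY.
Let dXl := reg_dif hX.
Let dYl := reg_dif hY.
Local Hint Resolve cXl cYl dXl dYl : lin.

Lemma linear_dgt_comp n : linear (@dgt_comp k X Y n).
Proof. by rewrite /dgt_comp; lin. Qed.

Lemma dgt_comp_pure n x y : dgt_comp n (x ⊗ y) =
  \sum_(i < n.+1) (@dg_comp k X (n - i) x ⊗ @dg_comp k Y i y).
Proof. by rewrite /dgt_comp tfold_pure //; lin. Qed.

Lemma dgt_comp_at n p q x y :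
  dg_comp p x = x -> dg_comp q y = y ->
  @dgt_comp k X Y n (x ⊗ y) = if n == (p + q)%N then x ⊗ y else 0.
Proof.
move=> hx hy; rewrite dgt_comp_pure.
have t0l (v : Y) : (0 : X) ⊗ v = 0 by apply: (linear_fun0 (f := fun u => u ⊗ v)); lin.
have t0r (u : X) : u ⊗ (0 : Y) = 0 by apply: (linear_fun0 (f := fun v => u ⊗ v)); lin.
have [hq|hq] := ltnP q n.+1; last first.
  rewrite big1 ?ifN // => [|i _].
    by rewrite neq_ltn (leq_trans hq) ?leq_addl.
  by rewrite (gr_at cY _ hy) ltn_eqF ?t0r // (leq_trans (ltn_ord i)).
rewrite (bigD1 (Ordinal hq)) //= hy (gr_at cX _ hx) big1 ?addr0 => [|i hi].
  by rewrite -{1}(eqn_add2r q) subnK // ; case: ifP => // _; rewrite t0l.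
by rewrite (gr_at cY _ hy) ifN // t0r.
Qed.

Lemma tensor_homog_ind (V : lmodType k) (f g : X ⨂ Y -> V) :
  linear f -> linear g ->
  (forall p q x y, dg_comp p x = x -> dg_comp q y = y ->
    f (x ⊗ y) = g (x ⊗ y)) -> f =1 g.
Proof.
move=> hf hg e; apply: tensor_ind => // x y.
apply: (gr_ind cX (f := fun x => f (x ⊗ y)) (g := fun x => g (x ⊗ y))) x.
- by lin.
- by lin.
move=> p x hx.
apply: (gr_ind cY (f := fun y => f (x ⊗ y)) (g := fun y => g (x ⊗ y))) y.
- by lin.
- by lin.
by move=> q y hy; exact: (e p q).
Qed.

(** Components of pure tensors of homogeneous elements are explicit, and being
    the sum of one's components is stable under addition. *)
Lemma dgt_grading : grading (@dgt_comp k X Y).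
Proof.
split=> [n|i j|]; first exact: linear_dgt_comp.
  have li := linear_dgt_comp i; have lj := linear_dgt_comp j.
  have [<-|ij] := eqVneq i j.
    apply: (tensor_homog_ind (f := fun t => dgt_comp i (dgt_comp i t))).
    - by lin.
    - by [].
    move=> p q x y hx hy; rewrite (dgt_comp_at i hx hy).
    by case: eqP => [e|_]; rewrite ?(dgt_comp_at i hx hy) ?e ?eqxx // linear_fun0.
  apply: (tensor_homog_ind (f := fun t => dgt_comp i (dgt_comp j t))
                           (g := fun=> 0)).
  - by lin.
  - by move=> a u v; rewrite scaler0 addr0.
  move=> p q x y hx hy; rewrite (dgt_comp_at j hx hy).
  case: eqP => [e|_]; last exact: linear_fun0.
  by rewrite (dgt_comp_at i hx hy) -e (negPf ij).
pose Q (t : X ⨂ Y) := exists N, forall M, (N <= M)%N -> t = \sum_(i < M) dgt_comp i t.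
suff hQ : forall t, Q t by move=> x; have [N h] := hQ x; exists N; apply: h.
have QD t s : Q t -> Q s -> Q (t + s).
  move=> [N1 h1] [N2 h2]; exists (maxn N1 N2) => M; rewrite geq_max => /andP[/h1 e1 /h2 e2].
  rewrite {1}e1 {1}e2 -big_split; apply: eq_bigr => i _ /=.
  by have := linear_dgt_comp i 1 t s; rewrite !scale1r.
have Q0 : Q 0.
  by exists 0%N => M _; rewrite big1 // => i _; apply: linear_fun0; apply: linear_dgt_comp.
move=> t; rewrite (tensor_sum t); apply: big_ind => // -[x y] _ /=.
have [N1 ->] := gr_sum cX x; have [N2 ->] := gr_sum cY y.
rewrite (linear_fun_sum (f := fun x => x ⊗ _)); last by lin.
apply: big_ind => // p _.
rewrite (linear_fun_sum (f := fun y => _ ⊗ y)); last by lin.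
apply: big_ind => // q _.
exists (p + q).+1 => M hM.
rewrite (bigD1 (Ordinal hM)) //= (dgt_comp_at _ (gr_homog cX _ _) (gr_homog cY _ _)).
rewrite eqxx big1 ?addr0 // => i hi.
by rewrite (dgt_comp_at _ (gr_homog cX _ _) (gr_homog cY _ _)) ifN.
Qed.

Lemma dgt_dif_aux x y :
  \sum_(i \in [set: nat]) (-1) ^+ i *: (@dg_comp k X i x ⊗ @dg_dif k Y y) =
  par (@dg_comp k X) 1 x ⊗ @dg_dif k Y y.
Proof.
move: x; apply: (gr_ind cX) => [||n x hx].
- by apply: (linear_gsum cX (F := fun i x => (-1) ^+ i *: (x ⊗ dg_dif y))) => i; lin.
- by apply: (@linear_compose _ _ _ _ (fun x => x ⊗ dg_dif y)); [lin|exact: par_lin].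
rewrite (gsum_at cX (F := fun i x => (-1) ^+ i *: (x ⊗ dg_dif y)) (n := n)) //;
  last by move=> i; lin.
by rewrite (par_at cX _ hx) muln1 (linear_funZ (f := fun x => x ⊗ _)) //; lin.
Qed.

Let dgt_dif_bilin : bilinear_for *:%R *:%R (fun (w : X) (e : Y) => (dg_dif w ⊗ e +
    \sum_(i \in [set: nat]) (-1) ^+ i *: (dg_comp i w ⊗ dg_dif e))).
Proof.
have pl := par_lin cX 1.
split=> [y a u v|x a u v]; rewrite /= !dgt_dif_aux.
  have h : linear (fun x => dg_dif x ⊗ y +
    par (@dg_comp k X) 1 x ⊗ @dg_dif k Y y) by lin.
  exact: h.
have h : linear (fun y => @dg_dif k X x ⊗ y +
  par (@dg_comp k X) 1 x ⊗ @dg_dif k Y y) by lin.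
exact: h.
Qed.

Lemma linear_dgt_dif : linear (@dgt_dif k X Y).
Proof. exact: tfold_linear. Qed.

Lemma dgt_dif_pure x y : @dgt_dif k X Y (x ⊗ y) =
  dg_dif x ⊗ y + par (@dg_comp k X) 1 x ⊗ dg_dif y.
Proof. by rewrite /dgt_dif tfold_pure // dgt_dif_aux. Qed.

Lemma dgt_dif_at p x y : dg_comp p x = x ->
  @dgt_dif k X Y (x ⊗ y) = dg_dif x ⊗ y + (-1) ^+ p *: (x ⊗ dg_dif y).
Proof.
move=> hx; rewrite dgt_dif_pure (par_at cX _ hx) muln1.
by rewrite (linear_funZ (f := fun x => x ⊗ _)) //; lin.
Qed.

Let mX u := reg_mull hX u.
Let mX' u := reg_mulr hX u.
Let mY u := reg_mull hY u.
Let mY' u := reg_mulr hY u.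
Local Hint Resolve mX mX' mY mY' : lin.

(** The summand of dgt_mul, with the arguments in the order of the sign. *)
Definition dgt_term (w : X) (e : Y) (w' : X) (e' : Y) : X ⨂ Y :=
  koszul (@dg_comp k X) (@dg_comp k Y)
    (fun e w' => dg_mul w w' ⊗ dg_mul e e') e w'.

Let dgt_term_bilin w e' :
  bilinear_for *:%R *:%R (fun (e : Y) (w' : X) => dg_mul w w' ⊗ dg_mul e e').
Proof. by lin. Qed.

Let dgt_term1 e w' e' : linear (fun w => dgt_term w e w' e').
Proof. by apply: linear_koszul => // u v; lin. Qed.
Let dgt_term2 w w' e' : linear (fun e => dgt_term w e w' e').
Proof. exact: (koszul_bilinear cX cY (dgt_term_bilin w e')).1. Qed.
Let dgt_term3 w e e' : linear (fun w' => dgt_term w e w' e').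
Proof. exact: (koszul_bilinear cX cY (dgt_term_bilin w e')).2. Qed.
Let dgt_term4 w e w' : linear (fun e' => dgt_term w e w' e').
Proof.
by apply: (@linear_koszul _ _ _ _ _ _ _ _ _ (fun e' e w' =>
  dg_mul w w' ⊗ dg_mul e e')) => *; lin.
Qed.

Lemma dgt_mulE s t : dgt_mul s t =
  \tsum_(w, e <- s) \tsum_(w', e' <- t) dgt_term w e w' e'.
Proof. by []. Qed.

Lemma linear_dgt_mull t : linear (fun s => @dgt_mul k X Y s t).
Proof.
suff h : linear (fun s => \tsum_(w, e <- s) \tsum_(w', e' <- t) dgt_term w e w' e').
  exact: h.
by lin.
Qed.

Lemma linear_dgt_mulr s : linear (@dgt_mul k X Y s).
Proof.
suff h : linear (fun t => \tsum_(w, e <- s) \tsum_(w', e' <- t) dgt_term w e w' e').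
  exact: h.
by lin.
Qed.

Lemma dgt_mul_at l x y x' y' : dg_comp l x' = x' ->
  @dgt_mul k X Y (x ⊗ y) (x' ⊗ y') =
  dg_mul x x' ⊗ dg_mul (par (@dg_comp k Y) l y) y'.
Proof.
move=> hx; rewrite dgt_mulE tfold_pure; last by lin.
rewrite tfold_pure; last by lin.
exact: (koszul_at cX cY _ (dgt_term_bilin x y') hx).
Qed.

End Regular.

(** * Differential calculi *)

Section CalculusRegular.
Variables (k : fieldType) (A : algType k) (O : calculus A).

Lemma calculus_grading : grading (hcomp O).
Proof.
split=> [n|i j x|x]; [exact: linearP | exact: hcomp_hcomp | exact: hcomp_sum].
Qed.

Lemma calculus_regular : dg_regular (dg_of O).
Proof.
split=> [|||]; [exact: calculus_grading | exact: linearP | move=> y | move=> x] => /=; lin.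
Qed.
End CalculusRegular.

Section Calculus.
Variables (k : fieldType) (A : algType k) (O : calculus A).
Let gO := calculus_grading O.

Lemma hcomp_inj0 a : hcomp O 0 (inj0 O a) = inj0 O a.
Proof. by apply/hcomp0; exists a. Qed.

Lemma hcomp_one : hcomp O 0 1 = 1.
Proof. by rewrite -(rmorph1 (inj0 O)) hcomp_inj0. Qed.

Lemma par_one l : par (hcomp O) l 1 = 1.
Proof. by rewrite (par_at gO l hcomp_one) mul0n scale1r. Qed.

Lemma dif_one : dif O 1 = 0.
Proof.
have := difM 1 hcomp_one; rewrite !mulr1 mul1r scale1r.
by move/(congr1 (fun x => x - dif O 1)); rewrite subrr addrK.
Qed.

Lemma hcomp_word a (s : seq A) :
  hcomp O (size s) (inj0 O a * \prod_(b <- s) dif O (inj0 O b)) =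
  inj0 O a * \prod_(b <- s) dif O (inj0 O b).
Proof.
elim/last_ind: s => [|s b IHs]; first by rewrite big_nil mulr1 hcomp_inj0.
rewrite size_rcons -cats1 big_cat big_seq1 mulrA -addn1.
by apply: hcompM IHs _; apply: hcomp_dif; apply: hcomp_inj0.
Qed.

(** Induction on the degree: a form of degree n + 1 is a sum of products of a form
    of degree n with a differential. The hypothesis is available on the whole of
    degree n, as coactions mix the forms of a given degree. *)
Lemma forms_ind (V : lmodType k) (f g : O -> V) : linear f -> linear g ->
  (forall a, f (inj0 O a) = g (inj0 O a)) ->
  (forall n w a, hcomp O n w = w ->
     (forall w', hcomp O n w' = w' -> f w' = g w') ->
     f (w * dif O (inj0 O a)) = g (w * dif O (inj0 O a))) ->
  f =1 g.
Proof.
move=> hf hg e0 eS; apply: (gr_ind gO hf hg); elim=> [w /hcomp0[a ->]//|n IHn w].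
case/forms_span=> s ->; rewrite !linear_fun_sum //; apply: eq_bigr => -[a t] _ /=.
case: t => t /= /eqP; case/lastP: t => // t b; rewrite size_rcons => -[ht].
rewrite -cats1 big_cat big_seq1 mulrA /=.
by apply: (eS n) => //; rewrite -ht; apply: hcomp_word.
Qed.

(** The inverse of inj0 on degree 0, extended by 0 to the other degrees. *)
Definition deg0 (w : O) : A :=
  projT1 (cid ((hcomp0 (hcomp O 0 w)).1 (gr_homog gO 0 w))).

Lemma inj0_deg0 w : inj0 O (deg0 w) = hcomp O 0 w.
Proof. by rewrite /deg0; case: cid. Qed.

Lemma deg0_inj0 a : deg0 (inj0 O a) = a.
Proof. by apply: (@inj0_inj _ _ O); rewrite inj0_deg0 hcomp_inj0. Qed.

Lemma linear_deg0 : linear deg0.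
Proof.
move=> c x y; apply: (@inj0_inj _ _ O).
by rewrite linearP /= !inj0_deg0 linearP.
Qed.

Lemma deg0_pos n w : hcomp O n.+1 w = w -> deg0 w = 0.
Proof.
move=> hw; apply: (@inj0_inj _ _ O).
by rewrite inj0_deg0 linear0 (gr_at gO 0 hw).
Qed.

(** Positive degrees form an ideal. *)
Lemma deg0M n m w w' : hcomp O n w = w -> hcomp O m w' = w' ->
  deg0 (w * w') = deg0 w * deg0 w'.
Proof.
case: n => [|n] hw; last first.
  by move=> hw'; rewrite (deg0_pos hw) mul0r (@deg0_pos (n + m)) // -addSn hcompM.
case: m => [|m] hw'; last first.
  by rewrite (deg0_pos hw') mulr0 (@deg0_pos m) // -[m.+1]add0n hcompM.
move: hw hw' => /hcomp0[a ->] /hcomp0[b ->].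
by rewrite -rmorphM !deg0_inj0.
Qed.

End Calculus.

Section FormAction.
Variables (k : fieldType) (H : hopfAlg k) (B : algType k) (T : twistedModule H B).
Variable OB : twistedCalculus T.

Lemma linear_diag_act (x : OB) s : linear (fun h => diag_act (form_act OB) h x s).
Proof. by elim: s x => [|y s IHs] x /=; lin. Qed.
Local Hint Resolve linear_diag_act : lin.

Lemma diag_act1 (x : OB) s : {in x :: s, forall y, form_act OB (1 ⊗ y) = y} ->
  diag_act (form_act OB) 1 x s = x * \prod_(y <- s) y.
Proof.
elim: s x => [|y s IHs] x h /=; first by rewrite big_nil mulr1 h ?mem_head.
rewrite comul1 tfold_pure; last by lin.
rewrite h ?mem_head // IHs ?big_cons // => z hz; apply: h.
by rewrite inE hz orbT.
Qed.

(** The unit of H is grouplike and acts trivially on functions and on their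
    differentials, hence on all words in them. *)
Lemma form_act1 w : form_act OB (1 ⊗ w) = w.
Proof.
move: w; apply: (gr_ind (calculus_grading OB)) => [||n w]; try by lin.
case/forms_span=> s ->; rewrite (linear_fun_sum (f := fun w => form_act OB (1 ⊗ w)));
  last by lin.
apply: eq_bigr => -[a t] _ /=; rewrite form_act_prod diag_act1 ?big_map // => y.
rewrite inE => /orP[/eqP->|/mapP[b _ ->]]; first by rewrite form_act_inj0 act1.
by rewrite form_act_dif act1.
Qed.

Lemma form_act_one h : form_act OB (h ⊗ 1) = (counit H h)%:A.
Proof. by rewrite -(rmorph1 (inj0 OB)) form_act_inj0 act_one linearZ. Qed.

End FormAction.

Section Sweedler.
Variables (k : fieldType) (H : hopfAlg k).

(** Coassociativity of a left coaction, or of the coproduct itself, under an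
    arbitrary trilinear expression. *)
Lemma coassoc3 (X V : lmodType k) (lam : X -> H ⨂ X) (G : H -> H -> X -> V) w :
  \tsum_(a, w0 <- lam w) \tsum_(h1, h2 <- comul H a) (h1 ⊗ (h2 ⊗ w0)) =
  \tsum_(h, a <- lam w) (h ⊗ lam a) ->
  (forall b c, linear (fun a => G a b c)) -> (forall a c, linear (fun b => G a b c)) ->
  (forall a b, linear (G a b)) ->
  \tsum_(a, w0 <- lam w) \tsum_(h1, h2 <- comul H a) G h1 h2 w0 =
  \tsum_(h1, a <- lam w) \tsum_(h2, w0 <- lam a) G h1 h2 w0.
Proof.
move=> e h1 h2 h3; pose F := tfold (fun a t => tfold (G a) t).
have hF : linear F by rewrite /F; lin.
have Fp a b c : F (a ⊗ (b ⊗ c)) = G a b c.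
  by rewrite /F tfold_pure; [rewrite tfold_pure|]; lin.
have := congr1 F e; rewrite !linear_fun_tfold // => {}e.
rewrite (eq_tfold (g := fun a x => F (\tsum_(h1, h2 <- comul H a) (h1 ⊗ (h2 ⊗ x))))) ?e.
  by apply: eq_tfold => a t; rewrite /F tfold_pure //; lin.
by move=> a b; rewrite linear_fun_tfold //; apply: eq_tfold => u v; rewrite Fp.
Qed.

End Sweedler.

(** * The extended coproduct on forms *)

Section FormCoproduct.
Variables (k : fieldType) (H : hopfAlg k) (OH : bicovCalculus H).
Local Notation lam := (lcoact OH).
Local Notation lamP := (lcoactP OH).
Local Notation dOH := (dg_of OH).
Local Notation hc := (hcomp OH).
Variable Delta : {linear dOH -> dgTensor dOH dOH}.
Hypothesis DeltaP : dg_morphism Delta.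
Hypothesis Delta_inj0 : forall h, Delta (inj0 OH h) =
  \tsum_(h1, h2 <- comul H h) (inj0 OH h1 ⊗ inj0 OH h2).

Let gH := calculus_grading OH.
Let rH := calculus_regular OH.
Let dml (t : OH ⨂ OH) : linear (fun s : OH ⨂ OH => @dgt_mul k dOH dOH s t) :=
  linear_dgt_mull rH rH t.
Let dmr (t : OH ⨂ OH) : linear (fun s : OH ⨂ OH => @dgt_mul k dOH dOH t s) :=
  linear_dgt_mulr rH rH t.
Let ddl : linear (fun s : OH ⨂ OH => @dgt_dif k dOH dOH s) := linear_dgt_dif rH rH.
Let pl l : linear (par hc l) := par_lin gH l.
Let Delta_lin : linear (fun w : OH => (Delta w : OH ⨂ OH)).
Proof. exact: linearP. Qed.
Local Hint Resolve dml dmr ddl pl Delta_lin : lin.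

Lemma Delta_mul (w w' : OH) : (Delta (w * w') : OH ⨂ OH) =
  @dgt_mul k dOH dOH (Delta w) (Delta w').
Proof. exact: (dg_morphM DeltaP). Qed.

Lemma Delta_dif (w : OH) : (Delta (dif OH w) : OH ⨂ OH) = @dgt_dif k dOH dOH (Delta w).
Proof. exact: (dg_morph_dif DeltaP). Qed.

Lemma OH_mul_at l (x y x' y' : OH) : hc l x' = x' ->
  @dgt_mul k dOH dOH (x ⊗ y) (x' ⊗ y') = (x * x') ⊗ (par hc l y * y').
Proof. exact: (dgt_mul_at rH rH (l := l)). Qed.

Lemma OH_dif_at p (x y : OH) : hc p x = x ->
  @dgt_dif k dOH dOH (x ⊗ y) = dif OH x ⊗ y + (-1) ^+ p *: (x ⊗ dif OH y).
Proof. exact: (dgt_dif_at rH rH). Qed.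

(* P3 and Q3 are the product and the differential of H ⨂ (OH ⨂ OH), with H in
   degree 0; Phi is id ⊗ Delta and Psi is the coaction on the first factor. *)
Let P3 (s s' : H ⨂ (OH ⨂ OH)) : H ⨂ (OH ⨂ OH) :=
  \tsum_(h, t <- s) \tsum_(h', t' <- s') ((h * h') ⊗ @dgt_mul k dOH dOH t t').
Let Q3 (s : H ⨂ (OH ⨂ OH)) : H ⨂ (OH ⨂ OH) :=
  \tsum_(h, t <- s) (h ⊗ @dgt_dif k dOH dOH t).
Let Phi (s : H ⨂ OH) : H ⨂ (OH ⨂ OH) := \tsum_(h, e <- s) (h ⊗ (Delta e : OH ⨂ OH)).
Let lamr (e2 : OH) (s : H ⨂ OH) : H ⨂ (OH ⨂ OH) := \tsum_(h, x <- s) (h ⊗ (x ⊗ e2)).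
Let Psi (t : OH ⨂ OH) : H ⨂ (OH ⨂ OH) := \tsum_(e1, e2 <- t) lamr e2 (lam e1).

Let linP3l t : linear (fun s => P3 s t). Proof. by rewrite /P3; lin. Qed.
Let linP3r t : linear (P3 t). Proof. by rewrite /P3; lin. Qed.
Let linQ3 : linear Q3. Proof. by rewrite /Q3; lin. Qed.
Let linPhi : linear Phi. Proof. by rewrite /Phi; lin. Qed.
Let linlamr e : linear (lamr e). Proof. by rewrite /lamr; lin. Qed.
Let linlamr' s : linear (fun e => lamr e s). Proof. by rewrite /lamr; lin. Qed.
Local Hint Resolve linP3l linP3r linQ3 linPhi linlamr linlamr' : lin.
Let linPsi : linear Psi. Proof. by rewrite /Psi; lin. Qed.
Let linPsil : linear (fun w : OH => Psi (Delta w)).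
Proof. by apply: (@linear_compose _ _ _ _ Psi (fun w : OH => (Delta w : OH ⨂ OH))). Qed.
Let lintmul s : linear (@tmul k H OH s). Proof. by rewrite /tmul; lin. Qed.
Let lintmul' s : linear (fun t => @tmul k H OH t s). Proof. by rewrite /tmul; lin. Qed.
Local Hint Resolve linPsi linPsil lintmul lintmul' : lin.

Let PhiM s s' : Phi (tmul s s') = P3 (Phi s) (Phi s').
Proof.
move: s; apply: tensor_ind => [||h e]; try by lin.
move: s'; apply: tensor_ind => [||h' e']; try by lin.
rewrite /tmul tfold_pure; last by lin.
rewrite tfold_pure; last by lin.
rewrite /Phi !tfold_pure; try by lin.
rewrite /P3 tfold_pure; last by lin.
by rewrite tfold_pure; [rewrite Delta_mul | lin].
Qed.

Let Phi_dif s : Phi (\tsum_(h, w0 <- s) (h ⊗ dif OH w0)) = Q3 (Phi s).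
Proof.
move: s; apply: tensor_ind => [||h e]; try by lin.
rewrite /Phi !tfold_pure; try by lin.
by rewrite /Q3 tfold_pure; [rewrite Delta_dif | lin].
Qed.

Let lamh n (w : OH) : hc n w = w -> lam w = \tsum_(h, w0 <- lam w) (h ⊗ hc n w0).
Proof. by move=> {1}<-; rewrite (lcov_comp lamP). Qed.

Let PsiM t t' : Psi (@dgt_mul k dOH dOH t t') = P3 (Psi t) (Psi t').
Proof.
move: t; apply: (tensor_ind) => [||x y]; try by lin.
move: t'; apply: (tensor_homog_ind rH rH) => [||p q x' y' hx' _]; try by lin.
rewrite (OH_mul_at _ _ _ hx') /Psi !tfold_pure; try by lin.
rewrite (lcovM lamP) (lamh hx').
move: (lam x) => s; move: s; apply: tensor_ind => [||h e]; try by lin.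
move: (lam x') => s; move: s; apply: tensor_ind => [||h' e']; try by lin.
rewrite tfold_pure; last by lin.
rewrite /tmul tfold_pure; last by lin.
rewrite tfold_pure; last by lin.
rewrite /lamr !tfold_pure; try by lin.
rewrite /P3 tfold_pure; last by lin.
rewrite tfold_pure; last by lin.
by rewrite (OH_mul_at _ _ _ (gr_homog gH _ _)).
Qed.

Let Psi_dif t : Psi (@dgt_dif k dOH dOH t) = Q3 (Psi t).
Proof.
move: t; apply: (tensor_homog_ind rH rH) => [||p q x y hx _]; try by lin.
rewrite (OH_dif_at _ hx) -[X in X + _]scale1r linPsi scale1r (linear_funZ _ _ linPsi).
rewrite /Psi !tfold_pure; try by lin.
rewrite (lcov_dif lamP) {1 2}(lamh hx) /=.
rewrite [in RHS](lamh hx).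
move: (lam x) => s; move: s; apply: tensor_ind => [||h e]; try by lin.
rewrite tfold_pure; last by lin.
rewrite /lamr !tfold_pure; try by lin.
rewrite /Q3 tfold_pure; last by lin.
rewrite (OH_dif_at _ (gr_homog gH _ _)) (linear_funD (f := tpure h)); last by lin.
by rewrite (linear_funZ (f := tpure h)) //; lin.
Qed.

(** Both composites are multiplicative and commute with the differentials, and
    on elements of H they agree by coassociativity. *)
Lemma Delta_lcoact w : \tsum_(h, e <- lam w) (h ⊗ (Delta e : OH ⨂ OH)) =
  \tsum_(e1, e2 <- (Delta w : OH ⨂ OH)) \tsum_(h, e <- lam e1) (h ⊗ (e ⊗ e2)).
Proof.
suff: Phi (lam w) = Psi (Delta w) by [].
have base a : Phi (lam (inj0 OH a)) = Psi (Delta (inj0 OH a)).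
  rewrite (lcov_inj0 lamP) Delta_inj0 !linear_fun_tfold //.
  transitivity (\tsum_(h1, a <- comul H a) \tsum_(h2, h3 <- comul H a)
     (h1 ⊗ (inj0 OH h2 ⊗ inj0 OH h3))).
    apply: eq_tfold => u v; rewrite /Phi tfold_pure; last by lin.
    by rewrite Delta_inj0 (linear_fun_tfold (f := tpure u)) //; lin.
  rewrite -(coassoc3 (G := fun h1 h2 h3 => h1 ⊗ (inj0 OH h2 ⊗ inj0 OH h3))
    (comulA a)); try by lin.
  apply: eq_tfold => u v; rewrite /Psi tfold_pure; last by lin.
  rewrite (lcov_inj0 lamP) (linear_fun_tfold (f := lamr _)) //.
  by apply: eq_tfold => x y; rewrite /lamr tfold_pure //; lin.
move: w; apply: forms_ind => [||//|n w a hw e]; try by lin.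
rewrite (lcovM lamP) PhiM e // Delta_mul PsiM.
by rewrite (lcov_dif lamP) Phi_dif base Delta_dif Psi_dif.
Qed.

(* Contraction of the first factor with the counit, extended by 0 to forms of
   positive degree. *)
Let Z (t : OH ⨂ OH) : OH := \tsum_(e1, e2 <- t) (counit H (deg0 e1) *: e2).
Let lin0 : linear (deg0 (O := OH)) := linear_deg0 (O := OH).
Local Hint Resolve lin0 : lin.
Let linZ : linear Z. Proof. by rewrite /Z; lin. Qed.
Local Hint Resolve linZ : lin.

Let ZM t t' : Z (@dgt_mul k dOH dOH t t') = Z t * Z t'.
Proof.
move: t; apply: (tensor_homog_ind rH rH) => [||p' q' x y hx _]; try by lin.
move: t'; apply: (tensor_homog_ind rH rH) => [||p q x' y' hx' _]; try by lin.
rewrite (OH_mul_at _ _ _ hx') /Z !tfold_pure; try by lin.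
rewrite (deg0M hx hx') counitM -scalerAl -scalerAr scalerA.
case: p hx' => [|p] hx'; last by rewrite (deg0_pos hx') linear0 mulr0 !scale0r.
by rewrite (par0 gH).
Qed.

Let Z_dif t : Z (@dgt_dif k dOH dOH t) = dif OH (Z t).
Proof.
move: t; apply: (tensor_homog_ind rH rH) => [||p q x y hx _]; try by lin.
rewrite (OH_dif_at _ hx) linear_funD // (linear_funZ _ _ linZ).
rewrite /Z !tfold_pure; try by lin.
rewrite (deg0_pos (hcomp_dif hx)) linear0 scale0r add0r [in RHS]linearZ /=.
case: p hx => [|p] hx; first by rewrite scale1r.
by rewrite (deg0_pos hx) linear0 !scale0r ?scaler0.
Qed.

(** The contraction commutes with products, because the Koszul sign is trivial
    unless the contracted factor has positive degree, and with differentials. *)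
Lemma Delta_counit w :
  \tsum_(e1, e2 <- (Delta w : OH ⨂ OH)) (counit H (deg0 e1) *: e2) = w.
Proof.
suff: Z (Delta w) = w by [].
have base a : Z (Delta (inj0 OH a)) = inj0 OH a.
  rewrite Delta_inj0 (linear_fun_tfold (f := Z)) // -[in RHS](counitl a).
  rewrite (linear_fun_tfold (f := inj0 OH)); last by lin.
  apply: eq_tfold => u v; rewrite /Z tfold_pure; last by lin.
  by rewrite deg0_inj0 linearZ.
have linZl : linear (fun w : OH => Z (Delta w)).
  by apply: (@linear_compose _ _ _ _ Z (fun w : OH => (Delta w : OH ⨂ OH))).
move: w; apply: (forms_ind (g := fun w => w)) => [||//|n w a hw e]; try by lin.
by rewrite Delta_mul ZM e // Delta_dif Z_dif base.
Qed.

(** * The crossed product of forms *)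

Section Crossed.
Variables (B : algType k) (T : twistedModule H B) (OB : twistedCalculus T).
Local Notation dOB := (dg_of OB).
Local Notation hb := (hcomp OB).
Local Notation X := (crossed_dg OH OB).
Let gB := calculus_grading OB.
Let rB := calculus_regular OB.

(** crossed_term as a function of the coacted forms λ(e) and λ(e'), in which it is
    bilinear and can thus be computed on pure tensors. *)
Definition cterm (w w' : OB) (s s' : H ⨂ OH) : OB ⨂ OH :=
  \tsum_(a, e0 <- s) \tsum_(h1, h2 <- comul H a) \tsum_(g, e0' <- s')
    ((w * form_act OB (h1 ⊗ w') * inj0 OB (coc T (h2 ⊗ g))) ⊗ (e0 * e0')).

Lemma cterm_lin1 w' s s' : linear (fun w => cterm w w' s s').
Proof. by rewrite /cterm; lin. Qed.
Lemma cterm_lin2 w s s' : linear (fun w' => cterm w w' s s').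
Proof. by rewrite /cterm; lin. Qed.
Lemma cterm_lin3 w w' s' : linear (fun s => cterm w w' s s').
Proof. by rewrite /cterm; lin. Qed.
Lemma cterm_lin4 w w' s : linear (cterm w w' s).
Proof. by rewrite /cterm; lin. Qed.
Local Hint Resolve cterm_lin1 cterm_lin2 cterm_lin3 cterm_lin4 : lin.

Let crossed_summand (w : OB) (e : OH) (w' : OB) (e' : OH) : OB ⨂ OH :=
  koszul hb hc (fun e w' => cterm w w' (lam e) (lam e')) e w'.

Let fbil w e' : bilinear_for *:%R *:%R (fun e w' => cterm w w' (lam e) (lam e')).
Proof. by lin. Qed.
Let crossed_summand_1 e w' e' : linear (fun w => crossed_summand w e w' e').
Proof. by apply: (@linear_koszul _ _ _ _ _ _ gB gH _ (fun w e w' =>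
  cterm w w' (lam e) (lam e'))) => *; lin. Qed.
Let crossed_summand_2 w w' e' : linear (fun e => crossed_summand w e w' e').
Proof. exact: (koszul_bilinear gB gH (fbil w e')).1. Qed.
Let crossed_summand_3 w e e' : linear (fun w' => crossed_summand w e w' e').
Proof. exact: (koszul_bilinear gB gH (fbil w e')).2. Qed.
Let crossed_summand_4 w e w' : linear (fun e' => crossed_summand w e w' e').
Proof. by apply: (@linear_koszul _ _ _ _ _ _ gB gH _ (fun e' e w' =>
  cterm w w' (lam e) (lam e'))) => *; lin. Qed.

Lemma linear_crossed_mull y : linear (fun x => @crossed_fmul k H OH B T OB x y).
Proof.
suff h : linear (fun s => \tsum_(w, e <- s) \tsum_(w', e' <- y) crossed_summand w e w' e').
  exact: h.
by lin.
Qed.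

Lemma linear_crossed_mulr x : linear (@crossed_fmul k H OH B T OB x).
Proof.
suff h : linear (fun t => \tsum_(w, e <- x) \tsum_(w', e' <- t) crossed_summand w e w' e').
  exact: h.
by lin.
Qed.

Lemma crossed_mul_at l (w w' : OB) (e e' : OH) : hb l w' = w' ->
  crossed_fmul (w ⊗ e) (w' ⊗ e') = cterm w w' (lam (par hc l e)) (lam e').
Proof.
move=> hw'; transitivity
  (\tsum_(w, e <- w ⊗ e) \tsum_(w', e' <- w' ⊗ e') crossed_summand w e w' e') => //.
rewrite tfold_pure; last by lin.
rewrite tfold_pure; last by lin.
exact: (koszul_at gB gH _ (fbil w e') hw').
Qed.

Lemma crossed_regular : dg_regular X.
Proof.
split; [exact: (dgt_grading rB rH) | exact: (linear_dgt_dif rB rH) |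
  exact: linear_crossed_mull | exact: linear_crossed_mulr].
Qed.

Let cml := linear_crossed_mull.
Let cmr := linear_crossed_mulr.
Local Hint Resolve cml cmr : lin.

(** The coaction on 1 is trivial, and the cocycle is normalized. *)
Lemma crossed_mul1 (w w' : OB) (e' : OH) :
  crossed_fmul (w ⊗ 1) (w' ⊗ e') = (w * w') ⊗ e'.
Proof.
move: w'; apply: (gr_ind gB (f := fun w' => crossed_fmul (w ⊗ 1) (w' ⊗ e'))
  (g := fun w' => (w * w') ⊗ e')) => [||l w' hw']; try by lin.
rewrite (crossed_mul_at _ _ _ hw') par_one (lcov1 lamP) /cterm.
rewrite tfold_pure; last by lin.
rewrite comul1 tfold_pure; last by lin.
rewrite form_act1 -[in RHS](lcov_counit lamP e') (linear_fun_tfold (f :=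
  tpure (w * w'))); last by lin.
apply: eq_tfold => h x; rewrite coc1l linearZ rmorph1 mul1r -scalerAr mulr1.
by rewrite (linear_funZ (f := fun w => w ⊗ x)) ?(linear_funZ (f := tpure _)) //; lin.
Qed.

(** * Extending the coaction *)

Let xml (t : (OB ⨂ OH) ⨂ OH) : linear (fun s : (OB ⨂ OH) ⨂ OH => @dgt_mul k X dOH s t) :=
  linear_dgt_mull crossed_regular rH t.
Let xmr (t : (OB ⨂ OH) ⨂ OH) : linear (fun s : (OB ⨂ OH) ⨂ OH => @dgt_mul k X dOH t s) :=
  linear_dgt_mulr crossed_regular rH t.
Let xdl : linear (fun s : (OB ⨂ OH) ⨂ OH => @dgt_dif k X dOH s) :=
  linear_dgt_dif crossed_regular rH.
Let bdl : linear (fun s : OB ⨂ OH => @dgt_dif k dOB dOH s) := linear_dgt_dif rB rH.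
Let bcl n : linear (fun s : OB ⨂ OH => @dgt_comp k dOB dOH n s) := linear_dgt_comp rB rH n.
Let xcl n : linear (fun s : (OB ⨂ OH) ⨂ OH => @dgt_comp k X dOH n s) :=
  linear_dgt_comp crossed_regular rH n.
Let hcl n : linear (fun s : OH ⨂ OH => @dgt_comp k dOH dOH n s) := linear_dgt_comp rH rH n.
Local Hint Resolve xml xmr xdl bdl bcl xcl hcl : lin.

Definition ext (w : OB) (t : OH ⨂ OH) : (OB ⨂ OH) ⨂ OH :=
  \tsum_(e1, e2 <- t) ((w ⊗ e1) ⊗ e2).
Let extl t : linear (fun w => ext w t). Proof. by rewrite /ext; lin. Qed.
Let extr w : linear (ext w). Proof. by rewrite /ext; lin. Qed.
Local Hint Resolve extl extr : lin.
Lemma ext_pure w e1 e2 : ext w (e1 ⊗ e2) = (w ⊗ e1) ⊗ e2.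
Proof. by rewrite /ext tfold_pure //; lin. Qed.

Definition crossed_Delta (x : OB ⨂ OH) : (OB ⨂ OH) ⨂ OH :=
  \tsum_(w, e <- x) ext w (Delta e).
Lemma linear_crossed_Delta : linear crossed_Delta. Proof. by rewrite /crossed_Delta; lin. Qed.
Let Dlin := linear_crossed_Delta.
Local Hint Resolve Dlin : lin.
Lemma crossed_Delta_pure w e : crossed_Delta (w ⊗ e) = ext w (Delta e).
Proof. by rewrite /crossed_Delta tfold_pure //; lin. Qed.

Lemma crossed_Delta_comp n x :
  crossed_Delta (@dgt_comp k dOB dOH n x) = @dgt_comp k X dOH n (crossed_Delta x).
Proof.
move: x; apply: (tensor_homog_ind rB rH) => [||p q w e hw he]; try by lin.
rewrite (dgt_comp_at rB rH _ hw he) crossed_Delta_pure.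
have eD : Delta e = @dgt_comp k dOH dOH q (Delta e).
  by rewrite -[in LHS](he : hc q e = e); apply: (dg_morph_comp DeltaP).
have -> : (if n == (p + q)%N then w ⊗ e else 0) =
    (if n == (p + q)%N then 1 else 0) *: (w ⊗ e).
  by case: ifP; rewrite ?scale1r ?scale0r.
rewrite (linear_funZ _ _ Dlin) crossed_Delta_pure eD.
move: (Delta e : OH ⨂ OH); apply: (tensor_homog_ind rH rH) => [||i j x y hx hy]; try by lin.
rewrite (dgt_comp_at rH rH _ hx hy).
case: (q =P _) => [->|_]; last by rewrite (linear_fun0 (extr w)) scaler0
  (linear_fun0 (xcl n)).
rewrite ext_pure (@dgt_comp_at k X dOH crossed_regular rH n (p + i) j _ _ _ hy).
  by rewrite addnA; case: ifP; rewrite ?scale1r ?scale0r.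
by rewrite /= (dgt_comp_at rB rH _ hw hx) eqxx.
Qed.

Lemma crossed_Delta_dif x :
  crossed_Delta (@dgt_dif k dOB dOH x) = @dgt_dif k X dOH (crossed_Delta x).
Proof.
move: x; apply: (tensor_homog_ind rB rH) => [||p q w e hw he]; try by lin.
rewrite (dgt_dif_at rB rH _ hw) linear_funD //
  (linear_funZ _ _ Dlin) !crossed_Delta_pure /=.
rewrite Delta_dif.
move: (Delta e : OH ⨂ OH); apply: (tensor_homog_ind rH rH) => [||i j x y hx hy]; try by lin.
have hwx : @dgt_comp k dOB dOH (p + i) (w ⊗ x) = w ⊗ x.
  by rewrite (dgt_comp_at rB rH _ hw hx) eqxx.
rewrite (dgt_dif_at rH rH _ hx) !ext_pure (@dgt_dif_at k X dOH crossed_regular rH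
  (p + i)) //=.
rewrite (dgt_dif_at rB rH _ hw) (linear_funD (f := ext w)) //.
rewrite (linear_funZ _ _ (extr w)) !ext_pure.
rewrite (linear_funD (f := fun u => u ⊗ y)); last by lin.
rewrite (linear_funZ (f := fun u => u ⊗ y)); last by lin.
by rewrite scalerDr scalerA exprD addrA.
Qed.

Let parT l (t : OH ⨂ OH) : OH ⨂ OH := \tsum_(x, y <- t) (par hc l x ⊗ par hc l y).
Let parTl l : linear (parT l). Proof. by rewrite /parT; lin. Qed.
Local Hint Resolve parTl : lin.

(** The degree of e is the total degree of its coproduct, so the sign of e is the
    product of the signs of the two factors. *)
Lemma Delta_par l (e : OH) : (Delta (par hc l e) : OH ⨂ OH) =
  \tsum_(x, y <- (Delta e : OH ⨂ OH)) (par hc l x ⊗ par hc l y).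
Proof.
change ((Delta (par hc l e) : OH ⨂ OH) = parT l (Delta e)).
move: e; apply: (gr_ind gH (f := fun e => (Delta (par hc l e) : OH ⨂ OH))
  (g := fun e => parT l (Delta e))) => [||n e he].
- exact: (@linear_compose _ _ _ _ (fun w : OH => (Delta w : OH ⨂ OH)) (par hc l)).
- exact: (@linear_compose _ _ _ _ (parT l) (fun w : OH => (Delta w : OH ⨂ OH))).
rewrite (par_at gH _ he) (linear_funZ _ _ Delta_lin).
have -> : Delta e = @dgt_comp k dOH dOH n (Delta e).
  by rewrite -[in LHS](he : hc n e = e); apply: (dg_morph_comp DeltaP).
move: (Delta e : OH ⨂ OH); apply: (tensor_homog_ind rH rH) => [||i j x y hx hy]; try by lin.
rewrite (dgt_comp_at rH rH _ hx hy).
case: (n =P _) => [->|_]; last by rewrite (linear_fun0 (parTl l)) scaler0.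
rewrite /parT tfold_pure; last by lin.
rewrite (par_at gH _ hx) (par_at gH _ hy) (linear_funZ (f := tpure _)); last by lin.
rewrite (linear_funZ (f := fun x => x ⊗ y)); last by lin.
by rewrite scalerA -exprD mulnDl addnC.
Qed.

(* The common value of both sides of multiplicativity: coacted forms on which
   the coproduct of forms has been applied as well. *)
Let K (w w' : OB) (s s' : H ⨂ (OH ⨂ OH)) : (OB ⨂ OH) ⨂ OH :=
  \tsum_(a, t <- s) \tsum_(h1, h2 <- comul H a) \tsum_(g, t' <- s')
    ext (w * form_act OB (h1 ⊗ w') * inj0 OB (coc T (h2 ⊗ g)))
        (@dgt_mul k dOH dOH t t').
Let K3 w w' s' : linear (fun s => K w w' s s'). Proof. by rewrite /K; lin. Qed.
Let K4 w w' s : linear (K w w' s). Proof. by rewrite /K; lin. Qed.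
Local Hint Resolve K3 K4 : lin.

Let crossed_Delta_cterm w w' s s' :
  crossed_Delta (cterm w w' s s') = K w w' (Phi s) (Phi s').
Proof.
move: s; apply: tensor_ind => [||a e]; try by lin.
move: s'; apply: tensor_ind => [||g e']; try by lin.
rewrite /cterm /Phi !tfold_pure; try by lin.
rewrite /K tfold_pure; last by lin.
rewrite (linear_fun_tfold _ _ Dlin); apply: eq_tfold => h1 h2.
rewrite !tfold_pure; try by lin.
by rewrite crossed_Delta_pure Delta_mul.
Qed.

Let K_ext w w' l (s : OH ⨂ OH) (t : OH ⨂ OH) : hb l w' = w' ->
  K w w' (Psi (parT l s)) (Psi t) = @dgt_mul k X dOH (ext w s) (ext w' t).
Proof.
move=> hw'; move: s; apply: tensor_ind => [||x y]; try by lin.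
move: t; apply: (tensor_homog_ind rH rH) => [||m q x' y' hx' _]; try by lin.
have hwx : @dgt_comp k dOB dOH (l + m) (w' ⊗ x') = w' ⊗ x'.
  by rewrite (dgt_comp_at rB rH _ hw' hx') eqxx.
rewrite !ext_pure (@dgt_mul_at k X dOH crossed_regular rH (l + m)) //=.
rewrite (crossed_mul_at _ _ _ hw') /parT tfold_pure; last by lin.
rewrite /Psi !tfold_pure; try by lin.
rewrite -[in lam x'](hx' : hc m x' = x') (lcov_comp lamP).
move: (lam (par hc l x)) => s; move: s; apply: tensor_ind => [||a e]; try by lin.
move: (lam x') => s; move: s; apply: tensor_ind => [||g e']; try by lin.
rewrite tfold_pure; last by lin.
rewrite /lamr !tfold_pure; try by lin.
rewrite /K /cterm !tfold_pure; try by lin.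
rewrite (linear_fun_tfold (f := fun u => u ⊗ _)); last by lin.
apply: eq_tfold => h1 h2; rewrite !tfold_pure; try by lin.
rewrite (OH_mul_at _ _ _ (gr_homog gH _ _)) ext_pure.
by rewrite (par_par gH).
Qed.

(** Coacting and then applying the coproduct on the left, the other way around on
    the right. *)
Lemma crossed_Delta_mul x y :
  crossed_Delta (crossed_fmul x y) = @dgt_mul k X dOH (crossed_Delta x) (crossed_Delta y).
Proof.
move: x; apply: tensor_ind => [||w e]; try by lin.
move: y; apply: (tensor_homog_ind rB rH) => [||l q w' e' hw' _]; try by lin.
rewrite (crossed_mul_at _ _ _ hw') crossed_Delta_cterm !crossed_Delta_pure.
rewrite /Phi !Delta_lcoact Delta_par.
exact: K_ext.
Qed.

(** * Uniqueness of the extension *)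

Lemma cterm11 (s s' : H ⨂ OH) : cterm (1 : OB) 1 s s' =
  \tsum_(h, x <- s) \tsum_(g, x' <- s') (inj0 OB (coc T (h ⊗ g)) ⊗ (x * x')).
Proof.
apply: eq_tfold => a x; rewrite exchange_tfold; apply: eq_tfold => g x'.
rewrite -[in RHS](counitl a) (linear_fun_tfold (f :=
  fun h => inj0 OB (coc T (h ⊗ g)) ⊗ (x * x'))); last by lin.
apply: eq_tfold => h1 h2; rewrite mul1r form_act_one -scalerAl mul1r.
rewrite (linear_funZ (f := fun u => u ⊗ _)); last by lin.
by rewrite (linear_funZ (f := fun h => inj0 OB (coc T (h ⊗ g)) ⊗ (x * x'))) //; lin.
Qed.

Lemma crossed_1mul1 (e e' : OH) : crossed_fmul ((1 : OB) ⊗ e) (1 ⊗ e') =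
  \tsum_(h, x <- lam e) \tsum_(g, x' <- lam e') (inj0 OB (coc T (h ⊗ g)) ⊗ (x * x')).
Proof.
by rewrite (crossed_mul_at _ _ _ (hcomp_one OB)) (par0 gH) cterm11.
Qed.

(* The right-hand side of
     1 ⊗ e e' = (σ^-1(e_{-1} ⊗ e'_{-1}) ⊗ 1) ((1 ⊗ e_0) (1 ⊗ e'_0)). *)
Let R (s s' : H ⨂ OH) : OB ⨂ OH := \tsum_(h, x <- s) \tsum_(g, x' <- s')
  crossed_fmul (inj0 OB (cocV T (h ⊗ g)) ⊗ 1) (crossed_fmul (1 ⊗ x) (1 ⊗ x')).
Let Rl s' : linear (fun s => R s s'). Proof. by rewrite /R; lin. Qed.
Let Rr s : linear (R s). Proof. by rewrite /R; lin. Qed.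
Local Hint Resolve Rl Rr : lin.

(** The product of 1 ⊗ e_0 and 1 ⊗ e'_0 creates a cocycle, which by coassociativity
    of the coaction meets its convolution inverse. *)
Lemma crossed_one_tensor_mul (e e' : OH) : R (lam e) (lam e') = 1 ⊗ (e * e').
Proof.
pose G h g h' g' x x' : OB ⨂ OH :=
  (inj0 OB (cocV T (h ⊗ g)) * inj0 OB (coc T (h' ⊗ g'))) ⊗ (x * x').
transitivity (\tsum_(h, e0 <- lam e) \tsum_(h', x <- lam e0)
   \tsum_(g, e0' <- lam e') \tsum_(g', x' <- lam e0') G h g h' g' x x').
  apply: eq_tfold => h e0; rewrite exchange_tfold; apply: eq_tfold => g e0'.
  rewrite crossed_1mul1 (linear_fun_tfold _ _ (cmr _)); apply: eq_tfold => h' x.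
  rewrite (linear_fun_tfold _ _ (cmr _)); apply: eq_tfold => g' x'.
  by rewrite crossed_mul1.
rewrite -(coassoc3 (G := fun h h' x => \tsum_(g, e0' <- lam e') 
  \tsum_(g', x' <- lam e0') G h g h' g' x x') (lcovA lamP e)); try by rewrite /G; lin.
transitivity (\tsum_(a, x <- lam e) \tsum_(b, x' <- lam e')
   ((counit H a * counit H b) *: (1 ⊗ (x * x')) : OB ⨂ OH)).
  apply: eq_tfold => a x.
  transitivity (\tsum_(h, h' <- comul H a) \tsum_(b, x' <- lam e')
      \tsum_(g, g' <- comul H b) G h g h' g' x x').
    apply: eq_tfold => h h'.
    by rewrite -(coassoc3 (G := fun g g' x' =>
      G h g h' g' x x') (lcovA lamP e')) // /G; lin.
  rewrite exchange_tfold; apply: eq_tfold => b x'.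
  rewrite -(linear_funZ (f := fun u : OB => u ⊗ (x * x'))); last by lin.
  have <- : inj0 OB ((counit H a * counit H b)%:A) = (counit H a * counit H b)%:A.
    by rewrite linearZ /= rmorph1.
  rewrite -(cocVK T) (linear_fun_tfold (f := fun v => inj0 OB v ⊗ (x * x'))); last by lin.
  apply: eq_tfold => h h'.
  rewrite (linear_fun_tfold (f := fun v => inj0 OB v ⊗ (x * x'))); last by lin.
  by apply: eq_tfold => g g'; rewrite rmorphM.
rewrite -[in RHS](lcov_counit lamP e) -[in RHS](lcov_counit lamP e').
rewrite (linear_fun_tfold (f := fun u => 1 ⊗ (u * _))); last by lin.
apply: eq_tfold => a x.
rewrite (linear_fun_tfold (f := fun u => 1 ⊗ (_ * u))); last by lin.
apply: eq_tfold => b x'.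
rewrite -scalerAl -scalerAr scalerA (linear_funZ (f := tpure 1)) //; lin.
Qed.

Lemma crossed_inj_pure b h : crossed_inj OH OB (b ⊗ h) = inj0 OB b ⊗ inj0 OH h.
Proof. by rewrite /crossed_inj tfold_pure //; lin. Qed.

Lemma crossed_dif_l w : @dgt_dif k dOB dOH (w ⊗ 1) = dif OB w ⊗ 1.
Proof.
rewrite (dgt_dif_pure rB rH) /= dif_one.
by rewrite (linear_fun0 (f := tpure _)) ?addr0 //; lin.
Qed.

Lemma crossed_dif_r e : @dgt_dif k dOB dOH (1 ⊗ e) = 1 ⊗ dif OH e.
Proof.
rewrite (dgt_dif_pure rB rH) /= dif_one par_one.
by rewrite (linear_fun0 (f := fun u => u ⊗ e)) ?add0r //; lin.
Qed.

(** Two extensions agree on the elements w ⊗ 1 and then, by induction on the degree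
    of e, on the elements 1 ⊗ e. *)
Lemma crossed_extension_unique
    (F G : {linear X -> dgTensor X dOH}) :
  crossed_extension F -> crossed_extension G -> F =1 G.
Proof.
move=> [hF hF0] [hG hG0].
have lF : linear (fun x : OB ⨂ OH => (F x : (OB ⨂ OH) ⨂ OH)) by exact: linearP.
have lG : linear (fun x : OB ⨂ OH => (G x : (OB ⨂ OH) ⨂ OH)) by exact: linearP.
pose FR := fun x : OB ⨂ OH => (F x : (OB ⨂ OH) ⨂ OH).
pose GR := fun x : OB ⨂ OH => (G x : (OB ⨂ OH) ⨂ OH).
have FM x y : FR (crossed_fmul x y) = @dgt_mul k X dOH (FR x) (FR y) by exact:
  (dg_morphM hF).
have GM x y : GR (crossed_fmul x y) = @dgt_mul k X dOH (GR x) (GR y) by exact: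
  (dg_morphM hG).
have FD x : FR (@dgt_dif k dOB dOH x) = @dgt_dif k X dOH (FR x) by exact: (dg_morph_dif hF).
have GD x : GR (@dgt_dif k dOB dOH x) = @dgt_dif k X dOH (GR x) by exact: (dg_morph_dif hG).
have e0 b h : FR (inj0 OB b ⊗ inj0 OH h) = GR (inj0 OB b ⊗ inj0 OH h).
  by rewrite -crossed_inj_pure /FR /GR hF0 hG0.
have eB0 b : FR (inj0 OB b ⊗ 1) = GR (inj0 OB b ⊗ 1).
  by rewrite -(rmorph1 (inj0 OH)) e0.
have eH0 h : FR (1 ⊗ inj0 OH h) = GR (1 ⊗ inj0 OH h).
  by rewrite -(rmorph1 (inj0 OB)) e0.
have eB w : FR (w ⊗ 1) = GR (w ⊗ 1).
  move: w; apply: (forms_ind (f := fun w => FR (w ⊗ 1)) (g :=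
    fun w => GR (w ⊗ 1))) => [|||n w a hw IH].
  - by rewrite /FR; lin.
  - by rewrite /GR; lin.
  - exact: eB0.
  by rewrite -crossed_mul1 -crossed_dif_l FM GM FD GD IH // eB0.
have eH e : FR (1 ⊗ e) = GR (1 ⊗ e).
  move: e; apply: (forms_ind (f := fun e => FR (1 ⊗ e)) (g :=
    fun e => GR (1 ⊗ e))) => [|||n e a he IH].
  - by rewrite /FR; lin.
  - by rewrite /GR; lin.
  - exact: eH0.
  rewrite -crossed_one_tensor_mul (lcov_dif lamP) (lcov_inj0 lamP) -{1 2}he
    (lcov_comp lamP).
  move: (lam e) (comul H a) => s t.
  move: s; apply: tensor_ind => [||h x]; rewrite /FR /GR; try by lin.
  move: t; apply: tensor_ind => [||g y]; try by lin.
  rewrite !tfold_pure; try by lin.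
  rewrite /R !tfold_pure; try by lin.
  rewrite -/(FR _) -/(GR _) !FM !GM eB IH ?(gr_homog gH) //.
  by rewrite -crossed_dif_r FD GD eH0.
apply: (tensor_ind lF lG) => w e.
by have := congr2 (@dgt_mul k X dOH) (eB w) (eH e); rewrite -FM -GM crossed_mul1 mulr1.
Qed.

(** * Base forms *)

Let counit_deg0_1 : counit H (deg0 (1 : OH)) = 1.
Proof. by rewrite -(rmorph1 (inj0 OH)) deg0_inj0 counit1. Qed.

(* id ⊗ ε, with ε extended by 0 to positive degrees. *)
Let E (x : OB ⨂ OH) : OB := \tsum_(w, e <- x) (counit H (deg0 e) *: w).
Let E_pure w e : E (w ⊗ e) = counit H (deg0 e) *: w.
Proof. by rewrite /E tfold_pure //; lin. Qed.

Lemma base_inj_linear : linear (fun w : OB => w ⊗ (1 : OH)).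
Proof. by lin. Qed.

Lemma crossed_comp_l n w : @dgt_comp k dOB dOH n (w ⊗ 1) = hb n w ⊗ 1.
Proof.
have lc := linear_dgt_comp rB rH n.
move: w; apply: (gr_ind (calculus_grading OB)
  (f := fun w => @dgt_comp k dOB dOH n (w ⊗ 1))) => [||p w hw]; try by lin.
rewrite (dgt_comp_at rB rH n hw (hcomp_one OH)) addn0.
rewrite (gr_at (calculus_grading OB) n hw); case: ifP => // _.
by rewrite (linear_fun0 (f := fun u => u ⊗ 1)) //; lin.
Qed.

Lemma base_inj_injective : injective (fun w : OB => w ⊗ (1 : OH)).
Proof.
by move=> u v /(congr1 E); rewrite !E_pure counit_deg0_1 !scale1r.
Qed.

Lemma crossed_Delta_extends (F : {linear X -> dgTensor X dOH}) :
  (forall x, F x = crossed_Delta x) -> crossed_extension F.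
Proof.
move=> eF.
have inj_pure b h : crossed_inj OH OB (b ⊗ h) = inj0 OB b ⊗ inj0 OH h.
  by apply: crossed_inj_pure.
have linj : linear (fun x => crossed_inj OH OB x : OB ⨂ OH) by rewrite /crossed_inj; lin.
split; first split=> [|x y|n x|x]; rewrite ?eF.
- rewrite crossed_Delta_pure (dg_morph1 DeltaP).
  exact: ext_pure.
- exact: crossed_Delta_mul.
- exact: crossed_Delta_comp.
- exact: crossed_Delta_dif.
move=> x; rewrite eF; move: x; apply: tensor_ind => [||b h].
- by lin.
- by rewrite /crossed_coact; lin.
rewrite inj_pure crossed_Delta_pure Delta_inj0 /crossed_coact tfold_pure; last by lin.
rewrite (linear_fun_tfold _ _ (extr _)).
rewrite (linear_fun_tfold (f := tfold (fun a0 h0 =>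
  crossed_inj OH OB a0 ⊗ inj0 OH h0))); last by lin.
apply: eq_tfold => h1 h2; rewrite ext_pure tfold_pure; last by lin.
by rewrite inj_pure.
Qed.

(** Contract the middle factor with the counit: the left-hand side becomes x and
    the right-hand side an element of OB ⊗ 1. *)
Lemma crossed_Delta_coinvariant x : crossed_Delta x = x ⊗ 1 <-> exists w, x = w ⊗ 1.
Proof.
split=> [eD|[w ->]]; last first.
  by rewrite crossed_Delta_pure (dg_morph1 DeltaP) ext_pure.
pose Y (s : (OB ⨂ OH) ⨂ OH) : OB ⨂ OH :=
  \tsum_(y, e2 <- s) \tsum_(w, e1 <- y) (w ⊗ (counit H (deg0 e1) *: e2)).
have linY : linear Y by rewrite /Y; lin.
have YD : Y (crossed_Delta x) = x.
  move: (x); apply: (tensor_ind (g := fun x => x)) => [||w e]; try by lin.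
  rewrite crossed_Delta_pure -[in RHS](Delta_counit e).
  rewrite (linear_fun_tfold (f := tpure w)); last by lin.
  rewrite (linear_fun_tfold _ _ linY); apply: eq_tfold => e1 e2.
  by rewrite /Y !tfold_pure //; lin.
exists (E x); rewrite -[LHS]YD eD /Y tfold_pure; last by lin.
rewrite /E (linear_fun_tfold (f := fun w => w ⊗ 1)); last by lin.
apply: eq_tfold => w e; rewrite (linear_funZ (f := tpure w)); last by lin.
by rewrite (linear_funZ (f := fun w => w ⊗ 1)) //; lin.
Qed.

End Crossed.
End FormCoproduct.

Theorem proposition4p3p24 (k : fieldType) (H : hopfAlg k)
    (OH : bicovCalculus H) (OH_complete : calculus_complete OH)
    (B : algType k) (T : twistedModule H B) (OB : twistedCalculus T) :
  [/\ crossed_complete OH OB,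
      forall D : {linear crossed_dg OH OB -> dgTensor (crossed_dg OH OB) (dg_of OH)},
        crossed_extension D -> base_forms D = [set w ⊗ 1 | w in [set: OB]] &
      exists J : {linear dg_of OB -> crossed_dg OH OB},
        [/\ forall w, J w = w ⊗ 1, injective J & dg_morphism J]].
Proof.
have [Delta [DeltaP Delta_inj0]] := OH_complete.
pose Dm := GRing.isLinear.Build k _ _ _ _ (linear_crossed_Delta (OB := OB) Delta).
pose D : {linear crossed_dg OH OB -> dgTensor (crossed_dg OH OB) (dg_of OH)} :=
  HB.pack (crossed_Delta (OB := OB) Delta) Dm.
have DP : crossed_extension D by apply: (crossed_Delta_extends DeltaP Delta_inj0).
split; first by exists D.
  move=> F FP; apply/seteqP; split=> [x|_ [w _ <-]]; rewrite /base_forms /=.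
    rewrite (crossed_extension_unique FP DP) =>
      /(crossed_Delta_coinvariant DeltaP Delta_inj0)[w ->].
    by exists w.
  by rewrite (crossed_extension_unique FP DP);
    apply/(crossed_Delta_coinvariant DeltaP Delta_inj0); exists w.
pose Jm := GRing.isLinear.Build k _ _ _ _ (@base_inj_linear k H OH B T OB).
pose J : {linear dg_of OB -> crossed_dg OH OB} := HB.pack (fun w : OB => w ⊗ (1 : OH)) Jm.
exists J; split=> //; first exact: base_inj_injective.
split=> [//|x y|n x|x] /=.
- by rewrite /J /= crossed_mul1.
- by rewrite /J /= crossed_comp_l.
- by rewrite /J /= crossed_dif_l.
Qed.
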